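(* Let $(R,\mathfrak m)$ be a Noetherian local ring, $E$ a finitely generated $R$-module having rank $e\ge 2$ and $U=\sum_{i=1}^rRa_i$ a reduction of $E$. Let $R''$, $E''$ and $F=\bigoplus_{i=1}^{e-1}R''x_i$ be as defined in the context. Let $x_1,\dots,x_n$ be a generating set of $E''$ containing the basis $x_1,\dots,x_{e-1}$ of $F$. Let $\varphi$ be an $n\times m$ matrix presenting $E''$ with respect to the generators $x_1,\dots,x_n$ (i.e. ${R''}^m\xrightarrow{\varphi}{R''}^n\to E''\to0$ is exact, the second map sending the canonical basis to $x_1,\dots,x_n$), and let $\psi$ be an $(n-e+1)\times(n-e)$ submatrix of $\varphi$, with rows $e,\dots,n$, satisfying $\operatorname{grade}I_{n-e}(\psi)\ge1$. Then there exists a complex of the form $$0\to{R''}^{n-e}\xrightarrow{\ \psi\ }{R''}^{n-e+1}\to I_{n-e}(\psi)\to0.$$ Suppose in addition that $E$ satisfies $\operatorname{grade}F_e(E)\ge2$. Then $E''/F$ is isomorphic to an $R''$-ideal $I=I_U(E)$ (a generic Bourbaki ideal of $E$ with respect to $U$) and $$I\simeq I_{n-e}(\psi).$$ Moreover, if $E$ is not free and $\operatorname{grade}I_{n-e}(\psi)\ge2$, then $I$ is perfect of grade $2$ with a finite free resolution $$0\to{R''}^{n-e}\xrightarrow{\ \psi\ }{R''}^{n-e+1}\to I\to0,$$ and $\psi$ defines a presentation of $I$ with respect to the generators $\overline{x_e},\dots,\overline{x_n}$, with $I=I_{n-e}(\psi)$.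
   Context: A finitely generated module $E$ over a Noetherian ring $R$ with total ring of fractions $Q$ has rank $e$ if $E\otimes_RQ\simeq Q^e$. $\tau_R(M)$ is the $R$-torsion submodule of $M$, i.e. the submodule of elements killed by a non-zero-divisor of $R$. For a finitely generated $E$ having a rank, the Rees algebra is $\mathcal R(E)=\mathcal S(E)/\tau_R(\mathcal S(E))$, with $\mathcal S(E)$ the symmetric algebra. A submodule $U\subseteq E$ is a reduction of $E$ if $\mathcal R(E)_{s+1}=(U/\tau_R(U))\cdot\mathcal R(E)_s$ for some $s\ge0$. $I_t(\cdot)$ is the ideal generated by the $t\times t$ minors; $F_i(E)=I_{p-i}(\varphi_0)$ is the $i$-th Fitting ideal, for any finite presentation $R^q\xrightarrow{\varphi_0}R^p\to E\to0$. An ideal $I$ of $R''$ is perfect of grade $2$ if $\operatorname{grade}I=\operatorname{proj\,dim}R''/I=2$. Construction: let $\mathbf Z=\{z_{ij}\mid1\le i\le r,\ 1\le j\le e-1\}$ be indeterminates over $R$, $R'=R[\mathbf Z]$, $R''=R'_{\mathfrak mR'}$ (a Nagata extension of $R$), $E''=E\otimes_RR''$, $x_j=\sum_{i=1}^rz_{ij}a_i\in E''$ for $1\le j\le e-1$, and $F=\sum_{j=1}^{e-1}R''x_j$, which is known to be a free $R''$-module with basis $x_1,\dots,x_{e-1}$. Write $\overline{x_i}=x_i+F\in E''/F$ for $e\le i\le n$; when $E''/F\simeq I$ these are viewed as generators of $I$. If $E''/F$ is isomorphic to an ideal $I$ of $R''$, then $I=I_U(E)$ is called a generic Bourbaki ideal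 of $E$ with respect to $U$.
   Formalization: The claim that E''/F is isomorphic to an R''-ideal is stated only for torsion-free E; as written it fails for R regular local of dimension 2, E = R^2 ⊕ k, U = E, and it can hold only when E is torsion-free. All other clauses are stated without this hypothesis. *)

(* Defs.v *)
From HB Require Import structures.
From mathcomp Require Import all_boot all_algebra.
From mathcomp Require Import boolp classical_sets.
From mathcomp Require Import freeg mpoly.

Set Implicit Arguments.
Unset Strict Implicit.
Unset Printing Implicit Defensive.

Import GRing.Theory.
Local Open Scope ring_scope.
Local Open Scope classical_set_scope.

(* Ideals of a commutative ring A are the submodules of A^o. *)
Definition is_submod (A : nzRingType) (M : lmodType A) (N : set M) : Prop :=
  N 0 /\ forall (a : A) (x y : M), N x -> N y -> N (a *: x + y).

Definition gen_submod (A : nzRingType) (M : lmodType A) (X : set M) : set M :=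
  smallest (@is_submod A M) X.

Lemma gen_submodP (A : nzRingType) (M : lmodType A) (X : set M) :
  is_submod (gen_submod X).
Proof.
split=> [N [[N0 _] _]|a x y Hx Hy N NX]; first exact: N0.
by case: (NX) => -[_ ND] _; apply: ND; [exact: Hx | exact: Hy].
Qed.

(* Boolean form of [gen_submod X], needed by the canonical structures of MathComp. *)
Definition in_gen (A : nzRingType) (M : lmodType A) (X : set M) : {pred M} :=
  fun x => `[< gen_submod X x >].

Lemma in_gen_closed (A : nzRingType) (M : lmodType A) (X : set M) :
  submod_closed (in_gen X).
Proof.
have [S0 SD] := gen_submodP X.
split=> [|a x y /asboolP Hx /asboolP Hy]; first exact/asboolP.
by apply/asboolP; apply: SD.
Qed.

HB.instance Definition _ (A : nzRingType) (M : lmodType A) (X : set M) :=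
  GRing.isSubmodClosed.Build A M (in_gen X) (in_gen_closed X).

(* The submodule of M generated by X, as a module in its own right; it is X
   itself when X is a submodule. *)
Record submod (A : nzRingType) (M : lmodType A) (X : set M) : Type :=
  Submod { submod_val : M; submod_valP : submod_val \in in_gen X }.

HB.instance Definition _ (A : nzRingType) (M : lmodType A) (X : set M) :=
  [isSub for @submod_val A M X].
HB.instance Definition _ (A : nzRingType) (M : lmodType A) (X : set M) :=
  [Choice of submod X by <:].
HB.instance Definition _ (A : nzRingType) (M : lmodType A) (X : set M) :=
  [SubChoice_isSubLmodule of submod X by <:].

(* The quotient of M by the submodule generated by X. *)
Definition quotmod (A : nzRingType) (M : lmodType A) (X : set M) : Type :=
  Quotient.quot (in_gen X : zmodClosed M).

Section QuotMod.
Local Open Scope quotient_scope.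
Variables (A : nzRingType) (M : lmodType A) (X : set M).

HB.instance Definition _ := Choice.on (quotmod X).
HB.instance Definition _ := GRing.Zmodule.on (quotmod X).
HB.instance Definition _ := Quotient.on (quotmod X).

Definition qproj (x : M) : quotmod X := \pi_(quotmod X) x.

Lemma qproj_eq (x y : M) : qproj x = qproj y <-> gen_submod X (x - y).
Proof.
split=> [/eqP|] H.
  by move: H; rewrite /qproj -Quotient.idealrBE => /asboolP.
by apply/eqP; rewrite /qproj -Quotient.idealrBE; apply/asboolP.
Qed.

Lemma qprojK (u : quotmod X) : qproj (repr u) = u.
Proof. exact: reprK. Qed.

Lemma qproj_is_zmod : zmod_morphism qproj.
Proof. by move=> x y; rewrite /qproj !piE. Qed.

HB.instance Definition _ :=
  GRing.isZmodMorphism.Build M (quotmod X) qproj qproj_is_zmod.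

Definition qscale (a : A) (u : quotmod X) : quotmod X := qproj (a *: repr u).

Lemma qscaleE a x : qscale a (qproj x) = qproj (a *: x).
Proof.
apply/qproj_eq; rewrite -scalerBr -[_ *: _]addr0.
have [S0 SD] := gen_submodP X; apply: (SD) => //.
exact/qproj_eq/qprojK.
Qed.

Lemma qscaleA a b u : qscale a (qscale b u) = qscale (a * b) u.
Proof. by rewrite -(qprojK u) !qscaleE scalerA. Qed.
Lemma qscale1 : left_id 1 qscale.
Proof. by move=> u; rewrite -(qprojK u) qscaleE scale1r. Qed.
Lemma qscaleDr : right_distributive qscale +%R.
Proof.
move=> a u v; rewrite -(qprojK u) -(qprojK v).
by rewrite -raddfD !qscaleE -raddfD scalerDr.
Qed.
Lemma qscaleDl u : {morph qscale^~ u : a b / a + b}.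
Proof. by move=> a b /=; rewrite -(qprojK u) !qscaleE -raddfD scalerDl. Qed.

HB.instance Definition _ := GRing.Zmodule_isLmodule.Build A (quotmod X)
  qscaleA qscale1 qscaleDr qscaleDl.

Lemma qproj_is_scalable : scalable qproj.
Proof. by move=> a x; rewrite -qscaleE. Qed.

HB.instance Definition _ :=
  GRing.isScalable.Build A M (quotmod X) *:%R qproj qproj_is_scalable.
End QuotMod.


(* M \otimes_A B, for B viewed as an A-algebra through f: the free B-module on
   the elements of M modulo additivity and A-linearity; [tens f x] is the
   element x \otimes 1. *)
Definition tensor_rel (A B : comNzRingType) (f : {rmorphism A -> B})
    (M : lmodType A) : set {freeg M / B} :=
  [set u | (exists x y : M, u = << x + y >> - << x >> - << y >>)
        \/ (exists (a : A) (x : M), u = << a *: x >> - f a *: << x >>)].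

Definition tensor (A B : comNzRingType) (f : {rmorphism A -> B})
    (M : lmodType A) : Type := quotmod (@tensor_rel A B f M).
HB.instance Definition _ (A B : comNzRingType) (f : {rmorphism A -> B})
  (M : lmodType A) := GRing.Lmodule.on (tensor f M).

Definition tens (A B : comNzRingType) (f : {rmorphism A -> B})
    (M : lmodType A) (x : M) : tensor f M :=
  qproj (@tensor_rel A B f M) << x >>.

Section Modules.
Variable A : comNzRingType.
Implicit Types L M N P : lmodType A.

Definition iso_mod M N : Prop := exists f : {linear M -> N}, bijective f.

Definition surj (S T : Type) (f : S -> T) : Prop := forall y, exists x, f x = y.

Definition exact_at L M N (f : L -> M) (g : M -> N) : Prop :=
  forall y, g y = 0 <-> exists x, f x = y.

Definition short_exact L M N (f : L -> M) (g : M -> N) : Prop :=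
  [/\ injective f, exact_at f g & surj g].

Definition fin_gen M : Prop := exists s : seq M, gen_submod [set` s] = [set: M].

Definition free_fin_rank M : Prop := exists d : nat, iso_mod M 'cV[A]_d.

(* [GRing.lreg s] says that s is a non-zero-divisor. *)
Definition torsion M : set M :=
  [set x | exists s : A, GRing.lreg s /\ s *: x = 0].

Definition torsion_free M : Prop := forall x : M, torsion x -> x = 0.

Definition projective P : Prop :=
  forall M N (p : {linear M -> N}) (f : {linear P -> N}),
    surj p -> exists g : {linear P -> M}, forall x, p (g x) = f x.

(* M has a projective resolution of length at most d. *)
Fixpoint pd_le (d : nat) (M : lmodType A) : Prop :=
  if d is d'.+1 then
    exists (P K : lmodType A) (i : {linear K -> P}) (p : {linear P -> M}),
      [/\ projective P, short_exact i p & pd_le d' K]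
  else projective M.

Definition proj_dim (M : lmodType A) (d : nat) : Prop :=
  pd_le d M /\ forall d', pd_le d' M -> (d <= d')%N.

Definition is_ideal (I : set A^o) : Prop := is_submod I.

Definition regular_seq (s : seq A) : Prop :=
  (forall (i : nat) (b : A^o), (i < size s)%N ->
     gen_submod [set` (take i s : seq A^o)] (s`_i * b : A^o) ->
     gen_submod [set` (take i s : seq A^o)] b)
  /\ ~ gen_submod [set` (s : seq A^o)] (1 : A^o).

(* grade I >= d, where grade I is the supremum of the lengths of the regular
   sequences contained in I, and grade A = +oo. *)
Definition grade_ge (I : set A^o) (d : nat) : Prop :=
  I = setT \/
  exists s : seq A, [/\ size s = d, {in s, forall a, I a} & regular_seq s].

Definition grade_eq (I : set A^o) (d : nat) : Prop :=
  grade_ge I d /\ ~ grade_ge I d.+1.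

Definition perfect_ideal (I : set A^o) (d : nat) : Prop :=
  grade_eq I d /\ proj_dim (quotmod I) d.

(* The ideal I_t(phi) generated by the t x t minors of phi. *)
Definition minors (p q : nat) (t : nat) (phi : 'M[A]_(p, q)) : set A^o :=
  gen_submod [set d : A^o | exists (f : 'I_t -> 'I_p) (g : 'I_t -> 'I_q),
    [/\ {homo f : i j / (i < j)%N}, {homo g : i j / (i < j)%N}
      & d = \det (mxsub f g phi)]].

(* A^q -- phi --> A^p -- (x_1 .. x_p) --> M --> 0 is exact. *)
Definition presents (p q : nat) (M : lmodType A) (phi : 'M[A]_(p, q))
    (x : 'I_p -> M) : Prop :=
  let g := fun v : 'cV[A]_p => \sum_(i < p) v i 0 *: x i in
  exact_at (fun w : 'cV[A]_q => phi *m w) g /\ surj g.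

(* The Fitting ideal F_i(M) = I_{p-i}(phi). It does not depend on the
   presentation, so the union over all finite presentations is I_{p-i}(phi)
   for any of them. For p <= i, p - i = 0 and I_0(phi) is the unit ideal. *)
Definition fitting (M : lmodType A) (i : nat) : set A^o :=
  [set a | exists (p q : nat) (phi : 'M[A]_(p, q)) (x : 'I_p -> M),
    presents phi x /\ minors (p - i) phi a].

Definition noetherian : Prop :=
  forall I : set A^o, is_ideal I -> exists s : seq A^o, I = gen_submod [set` s].

Definition maximal_ideal (I : set A^o) : Prop :=
  [/\ is_ideal I, I <> setT
    & forall J : set A^o, is_ideal J -> I `<=` J -> J = I \/ J = setT].

(* (A, m) is a local ring. *)
Definition local_ring (m : set A^o) : Prop :=
  maximal_ideal m /\ forall J : set A^o, maximal_ideal J -> J = m.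

End Modules.

(* f : A -> B exhibits B as the ring of fractions S^-1 A. *)
Definition is_localization (A B : comNzRingType) (S : set A)
    (f : {rmorphism A -> B}) : Prop :=
  [/\ forall s, S s -> exists u, f s * u = 1,
      forall b, exists a s, S s /\ b * f s = f a
    & forall a, f a = 0 -> exists s, S s /\ s * a = 0].

Definition total_fractions (A Q : comNzRingType) (f : {rmorphism A -> Q}) :=
  is_localization [set s | GRing.lreg s] f.

Definition has_rank (A : comNzRingType) (M : lmodType A) (e : nat) : Prop :=
  exists (Q : comNzRingType) (f : {rmorphism A -> Q}),
    total_fractions f /\ iso_mod (tensor f M) 'cV[Q]_e.

Section Rees.
Variables (A : comNzRingType) (M : lmodType A).

(* S, with sigma : M -> S, is the symmetric algebra of M. *)
Definition is_sym (S : comAlgType A) (sigma : {linear M -> S}) : Prop :=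
  forall (B : comAlgType A) (h : {linear M -> B}),
  exists g : {lrmorphism S -> B}, (forall x, g (sigma x) = h x) /\
    forall g' : {lrmorphism S -> B}, (forall x, g' (sigma x) = h x) -> g' =1 g.

(* T, with rho : M -> T, is the Rees algebra S(M) / torsion. *)
Definition is_rees (T : comAlgType A) (rho : {linear M -> T}) : Prop :=
  exists (S : comAlgType A) (sigma : {linear M -> S}) (p : {lrmorphism S -> T}),
    [/\ is_sym sigma, surj p, forall s, p s = 0 <-> torsion s
      & forall x, rho x = p (sigma x)].

(* The component of degree d of the graded algebra T. *)
Definition rees_deg (T : comAlgType A) (rho : {linear M -> T}) (d : nat)
    : set T :=
  gen_submod [set t : T | exists v : 'I_d -> M, t = \prod_(i < d) rho (v i)].

(* rho @` U is the copy of U / torsion in the component of degree 1. *)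
Definition is_reduction (U : set M) : Prop :=
  is_submod U /\
  exists (T : comAlgType A) (rho : {linear M -> T}), is_rees rho /\
  exists s : nat, rees_deg rho s.+1 =
    gen_submod [set t : T | exists u y, [/\ U u, rees_deg rho s y & t = rho u * y]].
End Rees.

Section GenericBourbaki.
Variables (R : comNzRingType) (r c : nat) (R2 : comNzRingType).

(* The r x c indeterminates z_ij are numbered by [mxvec_index]. *)
Variable loc : {rmorphism {mpoly R[r * c]} -> R2}.

(* loc exhibits R2 as the localization of R[Z] at the prime ideal m R[Z]. *)
Definition is_nagata (m : set R^o) : Prop :=
  is_localization
    (~` (gen_submod ((@mpolyC (r * c) R) @` m : set {mpoly R[r * c]}^o))) loc.

Definition nagata_map : {rmorphism R -> R2} := loc \o @mpolyC (r * c) R.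

Variable E : lmodType R.

Definition generic_elt (a : 'I_r -> E) (j : 'I_c) : tensor nagata_map E :=
  \sum_(i < r) loc 'X_(mxvec_index i j) *: tens nagata_map (a i).

Definition generic_sub (a : 'I_r -> E) : set (tensor nagata_map E) :=
  gen_submod (range (generic_elt a)).

(* I is a generic Bourbaki ideal of E with respect to the submodule generated
   by the a_i. *)
Definition generic_bourbaki (a : 'I_r -> E) (I : set R2^o) : Prop :=
  is_ideal I /\ iso_mod (quotmod (generic_sub a)) (submod I).
End GenericBourbaki.

Arguments generic_elt {R r c R2} loc {E} a j.
Arguments generic_sub {R r c R2} loc {E} a.
Arguments generic_bourbaki {R r c R2} loc {E} a I.

(* Main.v *)
(* Write c = e - 1, E'' / F = coker phi' with phi' the last k + 1 rows of phi, and
   d(v) = det [v | psi]. Since E has rank e, the (k+1)-minors of phi vanish, so d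
   factors through a surjection E'' / F -> I_k(psi) whose kernel is killed by
   I_k(psi). It is bijective as soon as E'' / F is torsion-free, or when
   grade I_k(psi) >= 2 by the exactness of the Hilbert-Burch complex.

   Torsion-freeness of E'' / F: let s v = \sum_j y_j x_j with s regular; one has to
   see that s divides y = y_j. The radical of (s) : y contains F_e(E), which has
   grade at least 2. Indeed a (p-e)-minor delta of a presentation gives
   coordinates E -> R^e, in which Cramer's rule puts det [x_1 .. x_(e-1), a_i] in
   this radical; as x_j is generic, two determinants mu * z + beta and
   mu * z' + beta' with distinct variables z, z' form a regular sequence up to
   powers of mu, so the x_j can be replaced one at a time by arbitrary a_i; as
   the a_i generate a reduction, these can be replaced by arbitrary elements
   of E, and a suitable choice gives a power of delta.

   If I_k(psi) = R'', then E'' has e generators, hence so does E, because m R'' is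
   proper; having rank e, E is then free. *)

From HB Require Import structures.
Require Import Defs.
From mathcomp Require Import all_boot perm all_algebra.
From mathcomp Require Import boolp classical_sets.
From mathcomp Require Import ring.
From mathcomp Require Import freeg mpoly.
Import GRing.Theory.
Local Open Scope ring_scope.
Local Open Scope classical_set_scope.
Set Implicit Arguments.
Unset Strict Implicit.
Unset Printing Implicit Defensive.

(** * Submodules and linear maps *)

(** The rank enters as a certificate made of matrices. Clearing denominators in the isomorphism of E
    (x) Q with Q^e gives H and C with H C = s, s regular, and H killing every relation; such a pair
    passes to R'' and to any finite generating family there, so that minors vanish by a determinant
    identity. If E is torsion-free, H moreover detects all relations, that is, it embeds E in R^e.
    Radicals are forced twice: removing a generic row costs a power of mu, and a reduction only
    controls a power of the values of a linear form. Nothing is lost in the end, since s divides y_j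
    as soon as it divides b1^N y_j and b2^N y_j for a regular pair b1, b2 taken in F_e(E). Then s (v
    - \sum_j (y_j / s) x_j) = 0, and v lies in F because E'' is torsion-free. That E'' / F is
    torsion-free has to be proved only to produce I; a given I provides it, by embedding E'' / F in
    R''. Perfection is checked on the definition: grade 3 would make I_k(psi) the unit ideal, and a
    resolution of length 1 would put 1 in I because every linear form on an ideal of grade at least
    2 is a multiplication. *)

Lemma gen_submod0 (A : nzRingType) (M : lmodType A) (X : set M) :
  gen_submod X 0.
Proof. by case: (gen_submodP X). Qed.

Lemma gen_submodD (A : nzRingType) (M : lmodType A) (X : set M) (u v : M) :
  gen_submod X u -> gen_submod X v -> gen_submod X (u + v).
Proof. by move=> Xu Xv; rewrite -[u]scale1r; apply: (gen_submodP X).2. Qed.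

Lemma gen_submodZ (A : nzRingType) (M : lmodType A) (X : set M) (b : A) (u : M) :
  gen_submod X u -> gen_submod X (b *: u).
Proof.
by move=> Xu; rewrite -[_ *: _]addr0; apply: (gen_submodP X).2 => //;
  apply: gen_submod0.
Qed.

Lemma gen_submod_sum (A : nzRingType) (M : lmodType A) (X : set M) (I : finType)
    (F : I -> M) :
  (forall i, gen_submod X (F i)) -> gen_submod X (\sum_i F i).
Proof.
move=> XF; elim/big_ind: _ => //; first exact: gen_submod0.
exact: gen_submodD.
Qed.

Lemma gen_submod_in (A : nzRingType) (M : lmodType A) (X : set M) (u : M) :
  X u -> gen_submod X u.
Proof. exact: sub_smallest. Qed.

Lemma gen_submod_min (A : nzRingType) (M : lmodType A) (X N : set M) :
  is_submod N -> X `<=` N -> gen_submod X `<=` N.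
Proof. by move=> HN XN; apply: smallest_sub. Qed.

Lemma gen_submod_id (A : nzRingType) (M : lmodType A) (N : set M) :
  is_submod N -> gen_submod N = N.
Proof.
move=> HN; apply/seteqP; split; first exact: gen_submod_min.
by move=> u; apply: gen_submod_in.
Qed.

Lemma gen_submod_range (A : nzRingType) (M : lmodType A) (n : nat)
    (y : 'I_n -> M) (v : M) :
  gen_submod (range y) v <-> exists c : 'cV[A]_n, v = \sum_i c i 0 *: y i.
Proof.
split; last first.
  case=> c ->; apply: gen_submod_sum => i; apply: gen_submodZ.
  by apply: gen_submod_in; exists i.
apply: (gen_submod_min (N := [set v | exists c : 'cV[A]_n, v = \sum_i c i 0 *: y i])).
  split=> [|b u w [c ->] [d ->]].
    by exists 0; rewrite big1 // => i _; rewrite mxE scale0r.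
  exists (b *: c + d); rewrite scaler_sumr -big_split /=.
  by apply: eq_bigr => i _; rewrite !mxE scalerDl scalerA.
move=> _ [j _ <-]; exists (delta_mx j 0); rewrite (bigD1 j) //= mxE !eqxx.
rewrite scale1r big1 ?addr0 // => i ij; rewrite mxE (negPf ij) /=.
by rewrite scale0r.
Qed.

Lemma ideal_mul (A : comNzRingType) (I : set A^o) (b x : A) :
  is_ideal I -> I x -> I (b * x).
Proof.
by case=> I0 ID Ix; have := ID b x 0 Ix I0; rewrite addr0.
Qed.

Lemma ideal_add (A : comNzRingType) (I : set A^o) (x y : A) :
  is_ideal I -> I x -> I y -> I (x + y).
Proof. by case=> I0 ID Ix Iy; have := ID 1 x y Ix Iy; rewrite scale1r. Qed.

Lemma lift_linear (A : nzRingType) (L M N : lmodType A)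
    (p : {linear L -> M}) (h : {linear L -> N}) :
  surj p -> (forall u, p u = 0 -> h u = 0) ->
  exists f : {linear M -> N}, forall u, f (p u) = h u.
Proof.
move=> psurj kerh; pose sec v := proj1_sig (cid (psurj v)).
have secK v : p (sec v) = v by exact: proj2_sig (cid (psurj v)).
have hE u v : p u = p v -> h u = h v.
  move=> /eqP; rewrite -subr_eq0 -linearB => /eqP/kerh.
  by rewrite linearB => /eqP; rewrite subr_eq0 => /eqP.
have lin : linear (h \o sec).
  by move=> a u v /=; rewrite -linearP; apply: hE; rewrite linearP !secK.
pose fM := GRing.isLinear.Build _ _ _ _ (h \o sec) lin.
pose f : {linear M -> N} := HB.pack (h \o sec) fM.
by exists f => u; apply: hE; rewrite secK.
Qed.

Definition lincomb (A : comNzRingType) (M : lmodType A) (p : nat)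
  (x : 'I_p -> M) (v : 'cV[A]_p) : M := \sum_(i < p) v i 0 *: x i.

Lemma lincomb_linear (A : comNzRingType) (M : lmodType A) (p : nat)
  (x : 'I_p -> M) : linear (lincomb x).
Proof.
move=> a u v; rewrite /lincomb scaler_sumr -big_split /=.
by apply: eq_bigr => i _; rewrite !mxE scalerDl scalerA.
Qed.

HB.instance Definition _ (A : comNzRingType) (M : lmodType A) (p : nat)
    (x : 'I_p -> M) :=
  GRing.isLinear.Build A 'cV[A]_p M *:%R (lincomb x) (lincomb_linear x).

Lemma lincomb_delta (A : comNzRingType) (M : lmodType A) (p : nat)
  (x : 'I_p -> M) (i : 'I_p) : lincomb x (delta_mx i 0) = x i.
Proof.
rewrite /lincomb (bigD1 i) //= mxE !eqxx scale1r big1 ?addr0 // => j ji.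
by rewrite mxE (negPf ji) scale0r.
Qed.

Lemma lincomb_mul (A : comNzRingType) (M : lmodType A) (p q : nat)
    (x : 'I_p -> M) (B : 'M[A]_(p, q)) (v : 'cV[A]_q) :
  lincomb x (B *m v) = lincomb (fun j => lincomb x (col j B)) v.
Proof.
rewrite /lincomb; under eq_bigr => i _ do rewrite mxE scaler_suml.
rewrite exchange_big /=; apply: eq_bigr => j _; rewrite scaler_sumr.
by apply: eq_bigr => i _; rewrite mxE scalerA mulrC.
Qed.

Lemma lincomb_linmap (A : comNzRingType) (M N : lmodType A) (p : nat)
    (x : 'I_p -> M) (f : {linear M -> N}) v :
  f (lincomb x v) = lincomb (f \o x) v.
Proof. by rewrite /lincomb linear_sum; apply: eq_bigr => i _; rewrite linearZ. Qed.

Lemma cV_linmap (A : comNzRingType) (M : lmodType A) (p : nat)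
    (f : {linear 'cV[A]_p -> M}) v :
  f v = lincomb (fun i => f (delta_mx i 0)) v.
Proof.
rewrite {1}[v]matrix_sum_delta linear_sum; apply: eq_bigr => i _.
by rewrite big_ord1 linearZ.
Qed.

(** Zero columns added to B and zero rows added to C make both factors square without changing the
    product, and the enlarged C has a zero row. *)
Lemma det_mulmx_wide (A : comNzRingType) (m n : nat) (B : 'M[A]_(m, n))
    (C : 'M[A]_(n, m)) : (n < m)%N -> \det (B *m C) = 0.
Proof.
move=> nm; have [d Em] : exists d, m = (n + d.+1)%N.
  by exists (m - n.+1)%N; rewrite addnS -addSn subnKC.
subst m.
have -> : B *m C = row_mx B (0 : 'M_(_, d.+1)) *m col_mx C 0.
  by rewrite mul_row_col mulmx0 addr0.
rewrite det_mulmx [X in _ * X](expand_det_row _ (rshift n ord0)) big1 ?mulr0 //.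
by move=> j _; rewrite col_mxEd mxE mul0r.
Qed.

(* A (k+1) x (k+1) minor formed with columns killed by H is, together with
   H C = s, a block of a product of two non-square matrices. *)
Lemma minor_vanish (A : comNzRingType) (e n t : nat) (s : A)
    (H : 'M[A]_(e, n)) (C : 'M[A]_(n, e)) (K : 'M[A]_(n, t)) (S : 'M[A]_(t, n)) :
  GRing.lreg s -> H *m C = s%:M -> H *m K = 0 -> (n < e + t)%N ->
  \det (S *m K) = 0.
Proof.
move=> sreg HC HK nlt; apply: (@lregX _ s e sreg); rewrite mulr0.
have := det_mulmx_wide (col_mx H S) (row_mx C K) nlt.
by rewrite mul_col_row HC HK det_lblock det_scalar.
Qed.

(** * Regular sequences and maximal minors *)

Lemma gen_submod_seq (A : nzRingType) (M : lmodType A) (s : seq M) (v : M) :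
  gen_submod [set` s] v <->
  exists c : 'cV[A]_(size s), v = \sum_i c i 0 *: s`_i.
Proof.
rewrite -gen_submod_range; suff -> : [set` s] = range (fun i : 'I_(size s) => s`_i) by [].
apply/seteqP; split=> [u /= us|_ [i _ <-] /=]; last by rewrite mem_nth.
have lt_us : (index u s < size s)%N by rewrite index_mem.
by exists (Ordinal lt_us) => //=; rewrite nth_index.
Qed.

(* A regular sequence of length two, except that (b1, b2) may be the unit ideal. *)
Definition reg_pair (A : comNzRingType) (b1 b2 : A) : Prop :=
  GRing.lreg b1 /\ forall y z, b2 * y = b1 * z -> exists c, y = b1 * c.

Lemma regular_seq_lreg (A : comNzRingType) (b : A) (s : seq A) :
  regular_seq (b :: s) -> GRing.lreg b.
Proof.
case=> reg _; apply: mulrI0_lreg => y by0; have := reg 0%N y isT.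
rewrite /= by0 => /(_ (@gen_submod0 _ A^o _))/gen_submod_seq[c ->].
by rewrite big_ord0.
Qed.

Lemma regular_seq_pair (A : comNzRingType) (b1 b2 : A) (s : seq A) :
  regular_seq [:: b1, b2 & s] -> reg_pair b1 b2.
Proof.
move=> reg12; split; first exact: regular_seq_lreg reg12.
case: reg12 => reg _ y z E; have := reg 1%N y isT.
rewrite /= ?take0 E => /(_ _)/gen_submod_seq[|c ->].
  apply/gen_submod_seq; exists (const_mx z); rewrite big_ord1 mxE.
  by rewrite mulrC.
by exists (c 0 0); rewrite big_ord1 mulrC.
Qed.

Lemma grade_ge1P (A : comNzRingType) (I : set A^o) :
  grade_ge I 1 -> exists b, I b /\ GRing.lreg b.
Proof.
case=> [->|]; first by exists 1; split=> //; apply: lreg1.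
case=> -[|b [|? ?]] [] // _ Is reg; exists b.
by split; [apply: Is; rewrite inE | apply: regular_seq_lreg reg].
Qed.

Lemma reg_pair1 (A : comNzRingType) : @reg_pair A 1 1.
Proof. by split=> [|y z _]; [exact: lreg1 | exists y; rewrite mul1r]. Qed.

(** Since [reg_pair] does not ask for properness, the pair (1, 1) covers the unit ideal, whose grade
    is infinite. *)
Lemma grade_ge2P (A : comNzRingType) (I : set A^o) :
  grade_ge I 2 -> exists b1 b2, [/\ I b1, I b2 & reg_pair b1 b2].
Proof.
case=> [->|]; first by exists 1, 1; split=> //; apply: reg_pair1.
case=> -[|b1 [|b2 [|? ?]]] [] // _ Is reg; exists b1, b2.
by split; [apply: Is; rewrite !inE eqxx ?orbT.. | apply: regular_seq_pair reg].
Qed.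

Lemma grade_ge3P (A : comNzRingType) (I : set A^o) :
  grade_ge I 3 -> exists b1 b2 b3, [/\ I b1, I b2, I b3, reg_pair b1 b2 &
    forall y z1 z2, b3 * y = b1 * z1 + b2 * z2 ->
      exists c1 c2, y = b1 * c1 + b2 * c2].
Proof.
case=> [->|].
  exists 1, 1, 1; split=> //; first exact: reg_pair1.
  by move=> y z1 z2 _; exists y, 0; rewrite mul1r mulr0 addr0.
case=> -[|b1 [|b2 [|b3 [|? ?]]]] [] // _ Is reg; exists b1, b2, b3.
split; try by apply: Is; rewrite !inE eqxx ?orbT.
  exact: regular_seq_pair reg.
case: reg => reg _ y z1 z2 E; have := reg 2%N y isT.
rewrite /= E => /(_ _)/gen_submod_seq[|c ->].
  rewrite ![b1 * _]mulrC ![b2 * _]mulrC.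
  apply: gen_submodD; apply: (gen_submodZ (M := A^o)); apply: gen_submod_in.
    by rewrite /= inE eqxx.
  by rewrite /= !inE eqxx orbT.
exists (c 0 0), (c (fintype.lift ord0 ord0) 0).
by rewrite !big_ord_recl big_ord0 addr0 /= ![_ *: _]mulrC.
Qed.

Lemma minors_ideal (A : comNzRingType) (p q t : nat) (phi : 'M[A]_(p, q)) :
  is_ideal (minors t phi).
Proof. exact: gen_submodP. Qed.

Definition signed_minor (A : comNzRingType) (k : nat) (psi : 'M[A]_(k.+1, k))
  (i : 'I_k.+1) : A := (-1) ^+ i * \det (row' i psi).

(* The Hilbert-Burch map v |-> \sum_i v_i * (-1)^i * \det (row' i psi), written as
   a determinant so that it visibly kills the image of psi. *)
Definition bordered_det (A : comNzRingType) (k : nat) (psi : 'M[A]_(k.+1, k))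
  (v : 'cV[A]_k.+1) : A := \det (row_mx v psi : 'M_(1 + k)).

Lemma cofactor_signed_minor (A : comNzRingType) (k : nat) (psi : 'M[A]_(k.+1, k))
    (v : 'cV[A]_k.+1) i :
  cofactor (row_mx v psi : 'M_(1 + k)) i 0 = signed_minor psi i.
Proof.
rewrite /cofactor /signed_minor addn0; congr (_ * \det _).
apply/matrixP=> a b; rewrite [RHS]mxE [LHS]mxE [LHS]mxE.
have -> : fintype.lift (0 : 'I_(1 + k)) b = rshift 1 b by apply/val_inj.
exact: (row_mxEr v).
Qed.

Lemma bordered_detE (A : comNzRingType) (k : nat) (psi : 'M[A]_(k.+1, k)) v :
  bordered_det psi v = \sum_i v i 0 * signed_minor psi i.
Proof.
rewrite /bordered_det (expand_det_col _ (0 : 'I_(1 + k))); apply: eq_bigr => i _.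
rewrite cofactor_signed_minor; congr (_ * _).
have -> : (0 : 'I_(1 + k)) = lshift k 0 by apply/val_inj.
exact: (row_mxEl v).
Qed.

Lemma bordered_det_linear (A : comNzRingType) (k : nat) (psi : 'M[A]_(k.+1, k)) :
  linear (bordered_det psi : 'cV[A]_k.+1 -> A^o).
Proof.
move=> a u v; rewrite !bordered_detE scaler_sumr -big_split /=.
by apply: eq_bigr => i _; rewrite !mxE mulrDl -mulrA.
Qed.

HB.instance Definition _ (A : comNzRingType) (k : nat) (psi : 'M[A]_(k.+1, k)) :=
  GRing.isLinear.Build A 'cV[A]_k.+1 A^o *:%R (bordered_det psi) (bordered_det_linear psi).

Lemma bordered_detZ (A : comNzRingType) (k : nat) (psi : 'M[A]_(k.+1, k)) a v :
  bordered_det psi (a *: v) = a * bordered_det psi v.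
Proof. exact: linearZ. Qed.

Lemma bordered_detD (A : comNzRingType) (k : nat) (psi : 'M[A]_(k.+1, k)) u v :
  bordered_det psi (u + v) = bordered_det psi u + bordered_det psi v.
Proof. exact: linearD. Qed.

Lemma bordered_det0 (A : comNzRingType) (k : nat) (psi : 'M[A]_(k.+1, k)) :
  bordered_det psi 0 = 0.
Proof. exact: linear0. Qed.

Lemma bordered_det_delta (A : comNzRingType) (k : nat) (psi : 'M[A]_(k.+1, k)) i :
  bordered_det psi (delta_mx i 0) = signed_minor psi i.
Proof.
rewrite bordered_detE (bigD1 i) //= mxE !eqxx mul1r big1 ?addr0 // => j ji.
by rewrite mxE (negPf ji) mul0r.
Qed.

Lemma bordered_det_mul (A : comNzRingType) (k : nat) (psi : 'M[A]_(k.+1, k)) (w : 'cV_k) :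
  bordered_det psi (psi *m w) = 0.
Proof.
rewrite /bordered_det -[X in row_mx _ X](mulmx1 psi) -mul_mx_row.
exact: det_mulmx_wide.
Qed.

Lemma signed_minor_minors (A : comNzRingType) (k : nat) (psi : 'M[A]_(k.+1, k)) i :
  minors k psi (signed_minor psi i).
Proof.
apply: (gen_submodZ (M := A^o)); apply: gen_submod_in.
exists (fintype.lift i), id; split=> //.
by move=> a b ab; rewrite /= ltnNge leq_bump2 -ltnNge.
Qed.

(** Selecting rows and columns is multiplication by 0-1 matrices; c is the product of their
    determinants. *)
Lemma det_mxsub_sq (A : comNzRingType) (k : nat) (M : 'M[A]_k) (f g : 'I_k -> 'I_k) :
  exists c, \det (mxsub f g M) = c * \det M.
Proof.
exists (\det (rowsub f (1%:M : 'M[A]_k)) * \det (colsub g (1%:M : 'M[A]_k))).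
rewrite mulrAC -!det_mulmx mul_rowsub_mx mul1mx mulmx_colsub mulmx1.
by congr (\det _); apply/matrixP=> i j; rewrite !mxE.
Qed.

(** The k rows of a minor miss some row i0, so the minor is a multiple of the one obtained by
    deleting i0. *)
Lemma minors_bordered_det (A : comNzRingType) (k : nat) (psi : 'M[A]_(k.+1, k)) (b : A) :
  minors k psi b <-> exists v, b = bordered_det psi v.
Proof.
split; last first.
  case=> v ->; rewrite bordered_detE; apply: (gen_submod_sum (M := A^o)) => i.
  by apply: (gen_submodZ (M := A^o)); apply: signed_minor_minors.
apply: (gen_submod_min (N := [set b : A^o | exists v, b = bordered_det psi v])).
  split=> [|a x y [u ->] [v ->]]; first by exists 0; rewrite bordered_det0.
  by exists (a *: u + v); rewrite bordered_detD bordered_detZ.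
move=> _ [f [g [_ _ ->]]].
have [i0 f0] : exists i0, forall i, i0 != f i.
  apply: contrapT => /forallNP nf.
  have /choice[h hK] : forall j, exists i, f i = j.
    move=> j; have /existsNP[i /negP] := nf j.
    by rewrite negbK => /eqP ->; exists i.
  have := leq_card h (can_inj hK); rewrite !card_ord.
  by rewrite ltnn.
have f'P i : {j | f i = fintype.lift i0 j} by have [j ->] := unlift_some (f0 i); exists j.
pose f' i := sval (f'P i).
have -> : mxsub f g psi = mxsub f' g (row' i0 psi).
  by apply/matrixP=> i j; rewrite !mxE /f'; case: (f'P i) => j0 /= ->.
have [c ->] := det_mxsub_sq (row' i0 psi) f' g.
exists ((c * (-1) ^+ i0) *: delta_mx i0 0); rewrite bordered_detZ bordered_det_delta /signed_minor.
by rewrite -mulrA signrMK.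
Qed.

(** * The Hilbert-Burch complex *)

(** Cramer's rule: column i of the adjugate of [v | psi] has the i-th signed minor as its first
    entry, and [v | psi] sends this column to the determinant times the i-th unit vector. *)
Lemma signed_minor_scale (A : comNzRingType) (k : nat) (psi : 'M[A]_(k.+1, k)) v i :
  exists w : 'cV_k, signed_minor psi i *: v = bordered_det psi v *: delta_mx i 0 - psi *m w.
Proof.
pose M := row_mx v psi : 'M_(1 + k).
pose c : 'cV_(1 + k) := col i (\adj M).
exists (dsubmx c).
have : M *m c = bordered_det psi v *: delta_mx i 0.
  by rewrite /c colE mulmxA mul_mx_adj mul_scalar_mx.
rewrite -[c in LHS]vsubmxK (mul_row_col v psi) => <-; rewrite addrK.
apply/matrixP=> a b; rewrite [LHS]mxE [RHS]mxE big_ord1 ord1 mulrC; congr (_ * _).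
rewrite -(cofactor_signed_minor psi v) !mxE; congr (cofactor _ _ _).
exact/val_inj.
Qed.

Lemma bordered_det_ker_torsion (A : comNzRingType) (k : nat) (psi : 'M[A]_(k.+1, k)) v b :
  bordered_det psi v = 0 -> minors k psi b -> exists w, b *: v = psi *m w.
Proof.
move=> v0 /minors_bordered_det[u ->]; rewrite bordered_detE scaler_suml.
have /choice[w wE] : forall i, exists w, signed_minor psi i *: v = psi *m w.
  move=> i; have [w ->] := signed_minor_scale psi v i; exists (- w).
  by rewrite v0 scale0r sub0r mulmxN.
exists (\sum_i u i 0 *: w i); rewrite mulmx_sumr; apply: eq_bigr => i _.
by rewrite -scalerA wE scalemxAr.
Qed.

(** Each square block of psi kills w, hence by the adjugate so does its minor, and b is a
    combination of these minors. *)
Lemma bordered_det_inj (A : comNzRingType) (k : nat) (psi : 'M[A]_(k.+1, k)) b (w : 'cV_k) :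
  minors k psi b -> GRing.lreg b -> psi *m w = 0 -> w = 0.
Proof.
move=> /minors_bordered_det[v ->] reg pw0.
have minor0 i : signed_minor psi i *: w = 0.
  have : row' i psi *m w = 0.
    rewrite mul_rowsub_mx pw0; apply/matrixP=> a b'.
    by rewrite !mxE.
  move=> /(congr1 (mulmx (\adj (row' i psi)))).
  rewrite mulmxA mul_adj_mx mulmx0 mul_scalar_mx => r0.
  by rewrite /signed_minor -scalerA r0 scaler0.
apply/matrixP=> a b'; apply: reg; rewrite [in RHS]mxE mulr0 bordered_detE mulr_suml.
rewrite big1 // => i _; rewrite -mulrA.
by have /matrixP/(_ a b') := minor0 i; rewrite !mxE => ->; rewrite mulr0.
Qed.

(** Both b1 v and b2 v lift along psi. Injectivity of psi gives b2 w1 = b1 w2, so the regular pair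
    allows w1 to be divided by b1. *)
Lemma bordered_det_exact (A : comNzRingType) (k : nat) (psi : 'M[A]_(k.+1, k)) b1 b2 v :
  minors k psi b1 -> minors k psi b2 -> reg_pair b1 b2 ->
  bordered_det psi v = 0 -> exists w, v = psi *m w.
Proof.
move=> Ib1 Ib2 [reg1 reg2] v0.
have [w1 w1E] := bordered_det_ker_torsion v0 Ib1; have [w2 w2E] := bordered_det_ker_torsion v0 Ib2.
have w12 : b2 *: w1 = b1 *: w2.
  apply/eqP; rewrite -subr_eq0; apply/eqP/(bordered_det_inj Ib1 reg1).
  by rewrite mulmxBr -!scalemxAr -w1E -w2E !scalerA mulrC subrr.
have /choice[c cE] : forall i, exists c, w1 i 0 = b1 * c.
  by move=> i; apply: (reg2 _ (w2 i 0)); have /matrixP/(_ i 0) := w12; rewrite !mxE.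
exists (\col_i c i); apply/matrixP=> a b; apply: reg1.
have /matrixP/(_ a b) := w1E; rewrite mxE => ->.
rewrite !mxE mulr_sumr; apply: eq_bigr => i _.
by rewrite mxE ord1 cE mulrCA.
Qed.

(** As u kills psi, u [v | psi] is (u v, 0, ..., 0). Multiplying by the adjugate leaves only its
    first row, which consists of the signed minors. *)
Lemma bordered_det_dual (A : comNzRingType) (k : nat) (psi : 'M[A]_(k.+1, k))
    (u : 'rV_k.+1) v :
  u *m psi = 0 -> bordered_det psi v *: u = (u *m v) 0 0 *: \row_i signed_minor psi i.
Proof.
move=> u0; pose M := row_mx v psi : 'M_(1 + k).
rewrite -mul_mx_scalar -(mul_mx_adj M) mulmxA.
rewrite [u *m M](mul_mx_row u v psi) u0.
apply/matrixP=> a b; rewrite ord1 mxE (bigD1 (0 : 'I_(1 + k))) //= big1.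
  have -> : (0 : 'I_(1 + k)) = lshift k 0 by apply/val_inj.
  rewrite (row_mxEl (u *m v)) addr0 [RHS]mxE [X in _ = _ * X]mxE; congr (_ * _).
  rewrite -(cofactor_signed_minor psi v) mxE; congr (cofactor _ _ _).
  exact/val_inj.
case=> [[|j] ltj] // _.
have -> : Ordinal ltj = rshift 1 (Ordinal (ltj : (j < k)%N)) by apply/val_inj.
by rewrite (row_mxEr (u *m v)) mxE mul0r.
Qed.

(** Exactness of the dual complex in the middle: the values u v1 and u v2 satisfy b2 (u v1) = b1 (u
    v2), and c is the common quotient by b1 and b2. *)
Lemma bordered_det_dual_exact (A : comNzRingType) (k : nat) (psi : 'M[A]_(k.+1, k)) b1 b2
    (u : 'rV_k.+1) :
  minors k psi b1 -> minors k psi b2 -> reg_pair b1 b2 ->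
  u *m psi = 0 -> exists c, u = c *: \row_i signed_minor psi i.
Proof.
move=> /minors_bordered_det[v1 ->] /minors_bordered_det[v2 ->] [reg1 reg2] u0.
have detmu v : \row_i signed_minor psi i *m v = (bordered_det psi v)%:M.
  apply/matrixP=> a b; rewrite !ord1 mxE mxE eqxx mulr1n bordered_detE.
  by apply: eq_bigr => i _; rewrite mxE mulrC.
have [|c cE] := reg2 ((u *m v1) 0 0) ((u *m v2) 0 0).
  have := congr1 (mulmx^~ v1) (bordered_det_dual v2 u0).
  rewrite -!scalemxAl detmu => /matrixP/(_ 0 0); rewrite !mxE eqxx mulr1n => ->.
  by rewrite mulrC.
exists c; apply/matrixP=> a b; apply: reg1.
have /matrixP/(_ a b) := bordered_det_dual v1 u0; rewrite mxE => ->.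
by rewrite cE !mxE -mulrA.
Qed.

(* If I = I_k(psi) contained a regular sequence b1, b2, b3, the cokernel of the
   transpose of psi, that is Ext^2(A / I, A), would be zero. *)
Lemma minors_grade3 (A : comNzRingType) (k : nat) (psi : 'M[A]_(k.+1, k)) :
  grade_ge (minors k psi) 3 -> minors k psi 1.
Proof.
move=> /grade_ge3P[b1 [b2 [b3 [Ib1 Ib2 Ib3 reg12 reg3]]]].
pose mu := \row_i signed_minor psi i.
have [reg1 reg2] := reg12.
have mu_inj c : c *: mu = 0 -> c = 0.
  move=> cmu0; apply: reg1; rewrite mulr0.
  have [v ->] := (minors_bordered_det psi b1).1 Ib1.
  rewrite bordered_detE mulr_suml big1 // => i _; have /matrixP/(_ 0 i) := cmu0.
  by rewrite !mxE -mulrA [_ * c]mulrC => ->; rewrite mulr0.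
have ker_mu u : u *m psi = 0 -> exists c, u = c *: mu.
  exact: bordered_det_dual_exact Ib1 Ib2 reg12.
have surj_tr (y : 'rV_k) : exists u : 'rV_k.+1, u *m psi = y.
  have sol b : minors k psi b -> exists u : 'rV_k.+1, u *m psi = b *: y.
    move=> /minors_bordered_det[v ->].
    pose M := row_mx v psi : 'M_(1 + k).
    exists (row_mx (0 : 'M_1) y *m \adj M).
    have : row_mx (0 : 'M_1) y *m \adj M *m M = bordered_det psi v *: row_mx 0 y.
      by rewrite -mulmxA mul_adj_mx mul_mx_scalar.
    rewrite [_ *m M](mul_mx_row _ v psi) scale_row_mx => /eq_row_mx[_ <-].
    by [].
  have [u1 u1E] := sol _ Ib1; have [u2 u2E] := sol _ Ib2.
  have [u3 u3E] := sol _ Ib3.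
  (* Two solutions for different b agree up to a multiple of mu after cross-multiplication. The
     coefficients satisfy b3 c12 = b2 c13 - b1 c23, so the third regular element gives c12 = b1 p +
     b2 p'; then u1 - p' mu is divisible by b1, and the quotient solves for y. *)
  have [|c12 c12E] := ker_mu (b2 *: u1 - b1 *: u2).
    by rewrite mulmxBl -!scalemxAl u1E u2E !scalerA mulrC subrr.
  have [|c13 c13E] := ker_mu (b3 *: u1 - b1 *: u3).
    by rewrite mulmxBl -!scalemxAl u1E u3E !scalerA mulrC subrr.
  have [|c23 c23E] := ker_mu (b3 *: u2 - b2 *: u3).
    by rewrite mulmxBl -!scalemxAl u2E u3E !scalerA mulrC subrr.
  have [|p [p' pE]] := reg3 c12 (- c23) c13.
    apply/eqP; rewrite -subr_eq0; apply/eqP/mu_inj.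
    rewrite mulrN opprD opprK addrA !scalerBl !scalerDl -!scalerA.
    rewrite -c12E -c13E -c23E !scalerBr !scalerA.
    rewrite (mulrC b3 b2) (mulrC b3 b1) (mulrC b2 b1).
    by rewrite opprB addrA addrACA !addrA; apply/matrixP=> i j; rewrite !mxE; ring.
  have /choice[w wE] : forall i, exists w, (u1 - p' *: mu) 0 i = b1 * w.
    move=> i; apply: (reg2 _ ((u2 + p *: mu) 0 i)).
    have /matrixP/(_ 0 i) := c12E; rewrite pE !mxE => E.
    apply/eqP; rewrite -subr_eq0; apply/eqP.
    transitivity (b2 * u1 0 i + - (b1 * u2 0 i) - (b1 * p + b2 * p') * signed_minor psi i); last by rewrite E subrr.
    by ring.
  exists (\row_i w i).
  have uw : u1 - p' *: mu = b1 *: \row_i w i.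
    by apply/matrixP=> i j; rewrite ord1 wE !mxE.
  apply/matrixP=> i j; apply: reg1; have /matrixP/(_ i j) := u1E.
  rewrite [in X in _ = X -> _]mxE => <-.
  have -> : u1 = p' *: mu + b1 *: \row_i w i by rewrite -uw addrC subrK.
  rewrite mulmxDl -!scalemxAl.
  have -> : mu *m psi = 0; last by rewrite scaler0 add0r [RHS]mxE.
  apply/matrixP=> a b; have := bordered_det_mul psi (delta_mx b 0 : 'cV_k).
  rewrite bordered_detE !mxE => E; rewrite -[RHS]E; apply: eq_bigr => l _.
  rewrite !mxE mulrC; congr (_ * _); rewrite (bigD1 b) //= mxE !eqxx mulr1.
  by rewrite big1 ?addr0 // => t tb; rewrite mxE (negPf tb) mulr0.
have /choice[r rE] : forall j : 'I_k, exists u : 'rV_k.+1, u *m psi = delta_mx 0 j.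
  by move=> j; apply: surj_tr.
pose rho := \matrix_(i < k, j < k.+1) r i 0 j.
have rho1 : rho *m psi = 1%:M.
  apply/row_matrixP => i; rewrite row_mul row1 -rE; congr (_ *m _); apply/matrixP=> a b.
  by rewrite ord1 !mxE.
(* P has trace (k + 1) - k = 1, and its rows are killed by psi, hence are multiples of the vector of
   minors; so 1 is a combination of minors. *)
pose P := 1%:M - psi *m rho.
have /choice[c cE] : forall i, exists c, row i P = c *: mu.
  move=> i; apply: ker_mu; rewrite -row_mul mulmxBl mul1mx -mulmxA rho1 mulmx1.
  by rewrite subrr row0.
have trP : \tr P = 1.
  by rewrite raddfB /= mxtrace_mulC rho1 !mxtrace1 -natrB // subSnn.
rewrite -trP; apply: (gen_submod_sum (M := A^o)) => i.
have /matrixP/(_ 0 i) := cE i; rewrite !mxE => ->.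
by apply: (gen_submodZ (M := A^o)); apply: signed_minor_minors.
Qed.

(** * Projective dimension and perfection in grade two *)

Lemma submod_val_inj (A : nzRingType) (M : lmodType A) (X : set M) :
  injective (@submod_val A M X).
Proof. exact: val_inj. Qed.

Lemma submodP (A : nzRingType) (M : lmodType A) (X : set M) (u : submod X) :
  gen_submod X (submod_val u).
Proof. by apply/asboolP; apply: submod_valP. Qed.

Lemma ideal_valP (A : comNzRingType) (I : set A^o) (u : submod I) :
  is_ideal I -> I (submod_val u).
Proof. by move=> Iid; have := submodP u; rewrite gen_submod_id. Qed.

Lemma submod_val_linear (A : nzRingType) (M : lmodType A) (X : set M) :
  linear (@submod_val A M X).
Proof. by move=> a u v; rewrite -[LHS]/(val _) linearP. Qed.

HB.instance Definition _ (A : nzRingType) (M : lmodType A) (X : set M) :=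
  GRing.isLinear.Build A (submod X) M *:%R (@submod_val A M X)
    (@submod_val_linear A M X).

Lemma corestrict (A : nzRingType) (L M : lmodType A) (X : set M)
    (h : {linear L -> M}) :
  (forall v, gen_submod X (h v)) ->
  exists f : {linear L -> submod X}, forall v, submod_val (f v) = h v.
Proof.
move=> Xh; have mem v : h v \in in_gen X by apply/asboolP.
pose f v := Submod (mem v).
have lin : linear f.
  by move=> a u v; apply: submod_val_inj; rewrite linearP /= linearP.
pose fM := GRing.isLinear.Build _ _ _ _ f lin.
pose f' : {linear L -> submod X} := HB.pack f fM.
by exists f'.
Qed.

Lemma bordered_det_corestrict (A : comNzRingType) (k : nat) (psi : 'M[A]_(k.+1, k)) :
  exists d : {linear 'cV[A]_k.+1 -> submod (minors k psi)},
    (forall v, submod_val (d v) = bordered_det psi v) /\ surj d.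
Proof.
have [v|d dE] := @corestrict A _ A^o (minors k psi) (bordered_det psi).
  by apply: gen_submod_in; apply/minors_bordered_det; exists v.
exists d; split=> // u; have := submodP u.
rewrite (gen_submod_id (minors_ideal _ _)) => /minors_bordered_det[v vE].
by exists v; apply: submod_val_inj; rewrite dE vE.
Qed.

Lemma projective_cV (A : comNzRingType) (n : nat) : projective 'cV[A]_n.
Proof.
move=> M N p f psurj.
have /choice[y yE] : forall i : 'I_n, exists y, p y = f (delta_mx i 0).
  by move=> i; apply: psurj.
exists (lincomb y) => v; rewrite lincomb_linmap [RHS]cV_linmap.
by apply: eq_bigr => i _; rewrite /= yE.
Qed.

Lemma projective_ring (A : comNzRingType) : projective A^o.
Proof.
move=> M N p f psurj; have [y yE] := psurj (f 1).
pose g (a : A^o) := a *: y.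
have lin : linear g by move=> a u v; rewrite /g scalerDl scalerA.
pose gM := GRing.isLinear.Build _ _ _ _ g lin.
pose g' : {linear A^o -> M} := HB.pack g gM.
by exists g' => x; rewrite linearZ /= yE -linearZ /= [x *: _]mulr1.
Qed.

(** By x h(y) = y h(x), h is multiplication by the fraction h(b1) / b1, which the regular pair turns
    into an element of A. *)
Lemma ideal_hom (A : comNzRingType) (I : set A^o) b1 b2 (h : {linear submod I -> A^o}) :
  is_ideal I -> I b1 -> I b2 -> reg_pair b1 b2 ->
  exists c, forall x, h x = c * submod_val x.
Proof.
move=> Iid Ib1 Ib2 [reg1 reg2].
have mem b : I b -> exists x : submod I, submod_val x = b.
  move=> Ib; have bI : b \in in_gen I by apply/asboolP; apply: gen_submod_in.
  by exists (Submod bI).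
have [x1 x1E] := mem _ Ib1; have [x2 x2E] := mem _ Ib2.
have comm x y : submod_val x * h y = submod_val y * h x.
  rewrite -[LHS]/(submod_val x *: h y) -[RHS]/(submod_val y *: h x) -!linearZ.
  congr (h _); apply: submod_val_inj; rewrite !linearZ; exact: mulrC.
have [|c cE] := reg2 (h x1) (h x2); first by rewrite -x1E -x2E comm.
exists c => x; apply: reg1; rewrite -x1E comm cE x1E mulrCA; congr (_ * _).
exact: mulrC.
Qed.

(** In length 0 the projection A -> A / I splits, but a linear map A / I -> A is zero as b1 is
    regular. In length 1, multiplication by [h y] on I factors through K and, K being projective,
    through A^n; by [ideal_hom] the map I -> A^n is given by a constant vector c, so [h y] is the
    image of c in I. Yet [h y] is 1 modulo I. *)
Lemma ideal_pd_ge2 (A : comNzRingType) (n : nat) (I : set A^o) b1 b2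
    (d : {linear 'cV[A]_n -> submod I}) (t : nat) :
  is_ideal I -> I b1 -> I b2 -> reg_pair b1 b2 -> surj d -> ~ I 1 ->
  pd_le t (quotmod I) -> (2 <= t)%N.
Proof.
move=> Iid Ib1 Ib2 reg12 dsurj I1; have [reg1 _] := reg12.
have q0 (y : A^o) : qproj I y = 0 <-> I y.
  rewrite -(linear0 (qproj I)) qproj_eq subr0 gen_submod_id //.
have qsurj : surj (qproj I) by move=> y; exists (repr y); apply: qprojK.
case: t => [|[|//]] /=.
  move=> /(_ A^o (quotmod I) (qproj I) idfun qsurj)[g gE].
  case: I1; apply/q0; have /= <- := gE (qproj I 1).
  suff -> : g (qproj I 1) = 0 by rewrite linear0.
  apply: reg1; rewrite mulr0 -[LHS]/(b1 *: _) -linearZ -linearZ /=.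
  have -> : qproj I (b1 *: 1) = 0 by apply/q0; rewrite [_ *: _]mulr1.
  by rewrite linear0.
case=> P [K [i [p [Pproj [iinj ip psurj] Kproj]]]].
case: I1; have [y yE] := psurj (qproj I 1).
have [h hE] := Pproj _ _ (qproj I) p qsurj.
(* [kap] is the map on kernels induced by A -> P, 1 |-> y. *)
have /choice[kap kapE] : forall x : submod I, exists z, i z = submod_val x *: y.
  move=> x; apply/ip; rewrite linearZ /= yE -linearZ; apply/q0.
  by rewrite [_ *: _]mulr1; apply: ideal_valP.
have kap_lin : linear kap.
  by move=> a u v; apply: iinj; rewrite linearP !kapE linearP /= scalerDl scalerA.
pose kapM := GRing.isLinear.Build _ _ _ _ kap kap_lin.
pose kap' : {linear submod I -> K} := HB.pack kap kapM.
have [|hi hiE] := @corestrict A K A^o I (h \o i).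
  move=> z; rewrite gen_submod_id //; apply/q0; rewrite /= hE.
  by apply/ip; exists z.
have [g gE] := Kproj _ _ d hi dsurj.
have coord j : exists c, forall x, (g (kap' x)) j 0 = c * submod_val x.
  have lin : linear (fun x => (g (kap' x)) j 0 : A^o).
    by move=> a u v; rewrite !linearP !mxE.
  pose cM := GRing.isLinear.Build _ _ _ _ (fun x => (g (kap' x)) j 0 : A^o) lin.
  pose c' : {linear submod I -> A^o} := HB.pack (fun x => (g (kap' x)) j 0 : A^o) cM.
  exact: (ideal_hom c' Iid Ib1 Ib2 reg12).
have /choice[c cE] := coord.
have b1I : b1 \in in_gen I by apply/asboolP; apply: gen_submod_in.
pose x1 : submod I := Submod b1I.
pose eps : A := h y.
have eps1 : I (1 - eps).
  by apply/q0; rewrite linearB /= hE yE subrr.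
(* Both sides are [hi (kap x1)]: once as multiplication by eps, once through the lift g to A^n. *)
have : b1 * eps = b1 * submod_val (d (\col_j c j)).
  rewrite -[LHS]/(b1 *: h y) -linearZ -[b1]/(submod_val x1) -kapE.
  rewrite -[LHS]/((h \o i) _) -hiE -gE -[RHS]/(submod_val x1 *: _) -!linearZ.
  congr (submod_val (d _)); apply/matrixP=> j l.
  by rewrite ord1 cE !mxE mulrC.
move=> /reg1 epsE; rewrite -[1](subrK eps); apply: ideal_add => //.
by rewrite epsE; apply: ideal_valP.
Qed.

Lemma bordered_det_short_exact (A : comNzRingType) (k : nat) (psi : 'M[A]_(k.+1, k))
    (d : {linear 'cV[A]_k.+1 -> submod (minors k psi)}) :
  grade_ge (minors k psi) 2 -> (forall v, submod_val (d v) = bordered_det psi v) -> surj d ->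
  short_exact (fun w : 'cV[A]_k => psi *m w) d.
Proof.
move=> /grade_ge2P[b1 [b2 [Ib1 Ib2 reg12]]] dE dsurj; split=> //.
  move=> u v /eqP; rewrite -subr_eq0 -mulmxBr => /eqP /(bordered_det_inj Ib1 reg12.1) /eqP.
  by rewrite subr_eq0 => /eqP.
move=> v; split=> [dv0|[w <-]]; last by apply: submod_val_inj; rewrite dE bordered_det_mul linear0.
have [|w ->] := bordered_det_exact Ib1 Ib2 reg12 (v := v); last by exists w.
by rewrite -dE dv0 linear0.
Qed.

Lemma minors_perfect (A : comNzRingType) (k : nat) (psi : 'M[A]_(k.+1, k)) :
  grade_ge (minors k psi) 2 -> ~ minors k psi 1 -> perfect_ideal (minors k psi) 2.
Proof.
move=> gr2 I1; have [d [dE dsurj]] := bordered_det_corestrict psi.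
have [b1 [b2 [Ib1 Ib2 reg12]]] := grade_ge2P gr2.
split; first by split=> // /minors_grade3.
split; last by move=> t; apply: (ideal_pd_ge2 (minors_ideal _ _) Ib1 Ib2 reg12 dsurj I1).
exists A^o, (submod (minors k psi)), (@submod_val _ _ _), (qproj (minors k psi)).
split; first exact: projective_ring.
  split; first exact: submod_val_inj.
    move=> y; rewrite -(linear0 (qproj (minors k psi))) qproj_eq subr0.
    split=> [yI|[x <-]]; last exact: submodP.
    have yI' : y \in in_gen (minors k psi) by apply/asboolP.
    by exists (Submod yI').
  by move=> y; exists (repr y); apply: qprojK.
exists 'cV[A]_k.+1, 'cV[A]_k, (mulmx psi), d; split; [exact: projective_cV| |exact: projective_cV].
exact: bordered_det_short_exact.
Qed.

(** * Base change and rank *)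

Lemma tensD (A B : comNzRingType) (f : {rmorphism A -> B}) (M : lmodType A) x y :
  @tens A B f M (x + y) = tens f x + tens f y.
Proof.
rewrite /tens -linearD; apply/qproj_eq; rewrite opprD addrA.
by apply: gen_submod_in; left; exists x, y.
Qed.

Lemma tensZ (A B : comNzRingType) (f : {rmorphism A -> B}) (M : lmodType A) a x :
  @tens A B f M (a *: x) = f a *: tens f x.
Proof.
rewrite /tens -linearZ; apply/qproj_eq.
by apply: gen_submod_in; right; exists a, x.
Qed.

Lemma tens0 (A B : comNzRingType) (f : {rmorphism A -> B}) (M : lmodType A) :
  @tens A B f M 0 = 0.
Proof. by rewrite -(scale0r 0) tensZ rmorph0 scale0r. Qed.

Lemma tens_lincomb (A B : comNzRingType) (f : {rmorphism A -> B}) (M : lmodType A)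
    (p : nat) (w : 'I_p -> M) (c : 'cV[A]_p) :
  tens f (lincomb w c) = lincomb (fun i => tens f (w i)) (map_mx f c).
Proof.
rewrite /lincomb.
have tens_sum (F : 'I_p -> M) : tens f (\sum_i F i) = \sum_i tens f (F i).
  by apply: (big_morph (@tens _ _ f M)); [exact: tensD | exact: tens0].
by rewrite tens_sum; apply: eq_bigr => i _; rewrite tensZ mxE.
Qed.

Lemma freeg_lift (B : nzRingType) (K : choiceType) (N : lmodType B) (h : K -> N) :
  exists g : {linear {freeg K / B} -> N}, forall x, g << x >> = h x.
Proof.
have hB : forall D D' : {freeg K / B}, fglift h (D - D') = fglift h D - fglift h D'.
  exact: lift_is_additive.
have h0 : fglift h 0 = 0 by rewrite -(subrr (0 : {freeg K / B})) hB subrr.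
have hD D D' : fglift h (D + D') = fglift h D + fglift h D'.
  by rewrite -{1}(opprK D') hB -(sub0r D') hB h0 sub0r opprK.
have scal (c : B) (D : {freeg K / B}) : fglift h (c *: D) = c *: fglift h D.
  rewrite {1}/GRing.scale /= /fgscale -[in RHS](freeg_sumE D).
  rewrite !(big_morph _ hD h0) scaler_sumr; apply: eq_bigr => x _.
  by rewrite !liftU scalerA.
have lin : linear (fglift h) by move=> c D1 D2; rewrite hD scal.
pose gM := GRing.isLinear.Build _ _ _ _ (fglift h) lin.
pose g : {linear {freeg K / B} -> N} := HB.pack (fglift h) gM.
by exists g => x; rewrite -[g _]/(fglift h _) liftU scale1r.
Qed.

Lemma quot_lift (A : nzRingType) (M N : lmodType A) (X : set M) (h : {linear M -> N}) :
  (forall x, X x -> h x = 0) ->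
  exists g : {linear quotmod X -> N}, forall x, g (qproj X x) = h x.
Proof.
move=> X0; apply: lift_linear => [y|u]; first by exists (repr y); apply: qprojK.
move/eqP; rewrite -(linear0 (qproj X)) => /eqP/qproj_eq; rewrite subr0.
apply: (gen_submod_min (N := [set v | h v = 0])) => //.
split=> [|a x y /= hx hy]; first exact: linear0.
by rewrite linearP hx hy scaler0 addr0.
Qed.

Lemma tensor_lift (A B : comNzRingType) (f : {rmorphism A -> B}) (M : lmodType A)
    (N : lmodType B) (h : M -> N) :
  (forall x y, h (x + y) = h x + h y) -> (forall a x, h (a *: x) = f a *: h x) ->
  exists g : {linear tensor f M -> N}, forall x, g (tens f x) = h x.
Proof.
move=> hD hZ; have [g gE] := @freeg_lift B M N h.
have [|g' g'E] := @quot_lift B _ N (@tensor_rel A B f M) g.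
  move=> _ [[x [y ->]]|[a [x ->]]].
    by rewrite !linearB /= !gE hD addrAC addrK subrr.
  by rewrite linearB linearZ /= !gE hZ subrr.
by exists g' => x; rewrite g'E gE.
Qed.

Lemma tensor_gen (A B : comNzRingType) (f : {rmorphism A -> B}) (M : lmodType A)
    (p : nat) (w : 'I_p -> M) :
  surj (lincomb w) -> surj (lincomb (fun i => tens f (w i))).
Proof.
move=> wsurj u; rewrite -(qprojK u) -(freeg_sumE (repr u)) linear_sum.
have /choice[c cE] := wsurj.
exists (\sum_(x <- dom (repr u)) coeff x (repr u) *: map_mx f (c x)).
rewrite linear_sum; apply: eq_bigr => x _.
rewrite linearZ /= -tens_lincomb cE /tens -linearZ; congr (qproj _ _).
apply/eqP/freeg_eqP => y.
by rewrite coeffZ !coeffU mul1r.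
Qed.

(** Right exactness of the tensor product. Sending x to the class of any of its coordinate vectors
    is well defined modulo X and extends to [tensor f M]; the combination with coefficients v goes
    to the class of v, which therefore vanishes. *)
Lemma tensor_relation (A B : comNzRingType) (f : {rmorphism A -> B})
    (M : lmodType A) (p : nat) (w : 'I_p -> M) (v : 'cV[B]_p) :
  surj (lincomb w) -> lincomb (fun i => tens f (w i)) v = 0 ->
  gen_submod [set u | exists c, lincomb w c = 0 /\ u = map_mx f c] v.
Proof.
move=> wsurj v0; set X := [set u | _].
have /choice[c cE] := wsurj.
have relP c1 c2 : lincomb w c1 = lincomb w c2 ->
    qproj X (map_mx f c1) = qproj X (map_mx f c2).
  move=> c12; apply/qproj_eq; apply: gen_submod_in; exists (c1 - c2).
  by rewrite linearB /= c12 subrr map_mxB.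
have [||g gE] := @tensor_lift A B f M (quotmod X) (fun x => qproj X (map_mx f (c x))).
- by move=> x y; rewrite -linearD -map_mxD; apply: relP; rewrite linearD /= !cE.
- by move=> a x; rewrite -linearZ -map_mxZ; apply: relP; rewrite linearZ /= !cE.
suff : qproj X v = 0.
  by move/eqP; rewrite -(linear0 (qproj X)) => /eqP/qproj_eq; rewrite subr0.
have <- : g (lincomb (fun i => tens f (w i)) v) = qproj X v; last by rewrite v0 linear0.
rewrite lincomb_linmap [RHS]cV_linmap; apply: eq_bigr => i _; congr (_ *: _).
rewrite /= gE; have -> : (delta_mx i 0 : 'cV[B]_p) = map_mx f (delta_mx i 0 : 'cV[A]_p) by rewrite map_delta_mx.
by apply: relP; rewrite cE lincomb_delta.
Qed.

Lemma fin_genP (A : comNzRingType) (M : lmodType A) :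
  fin_gen M -> exists (p : nat) (w : 'I_p -> M), surj (lincomb w).
Proof.
case=> s sT; exists (size s), (fun i => s`_i) => v.
have : gen_submod [set` s] v by rewrite sT.
by case/gen_submod_seq => c ->; exists c.
Qed.

(** The denominator t comes with an inverse of [f t] rather than with membership in S: S is an
    arbitrary set, whereas units can be multiplied. *)
Lemma loc_common (A B : comNzRingType) (S : set A) (f : {rmorphism A -> B})
    (I : finType) (b : I -> B) :
  is_localization S f ->
  exists t u, f t * u = 1 /\ forall i, exists a, f t * b i = f a.
Proof.
case=> unitS fracS _.
have /choice[s sP] : forall i, exists su : A * B,
    f su.1 * su.2 = 1 /\ exists a, b i * f su.1 = f a.
  move=> i; have [a [s [Ss E]]] := fracS (b i); have [u uE] := unitS _ Ss.
  by exists (s, u); split=> //; exists a.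
exists (\prod_i (s i).1), (\prod_i (s i).2); split.
  by rewrite rmorph_prod -big_split /= big1 // => i _; case: (sP i).
move=> i; have [_ [a aE]] := sP i; exists ((\prod_(j | j != i) (s j).1) * a).
by rewrite (bigD1 i) //= !rmorphM -aE; ring.
Qed.

Lemma loc_common_mx (A B : comNzRingType) (S : set A) (f : {rmorphism A -> B})
    (m n : nat) (M : 'M[B]_(m, n)) :
  is_localization S f ->
  exists t u N, f t * u = 1 /\ f t *: M = map_mx f N.
Proof.
move=> locf; have [t [u [tu tP]]] := loc_common (fun ij : 'I_m * 'I_n => M ij.1 ij.2) locf.
have /choice[a aE] := tP; exists t, u, (\matrix_(i, j) a (i, j)); split=> //.
by apply/matrixP=> i j; rewrite !mxE -aE.
Qed.

Lemma loc_ker_mx (A B : comNzRingType) (S : set A) (f : {rmorphism A -> B})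
    (m n : nat) (M : 'M[A]_(m, n)) :
  is_localization S f -> map_mx f M = 0 ->
  exists t u, f t * u = 1 /\ t *: M = 0.
Proof.
case=> unitS _ kerS M0.
have /choice[s sP] : forall ij : 'I_m * 'I_n, exists su : A * B,
    f su.1 * su.2 = 1 /\ su.1 * M ij.1 ij.2 = 0.
  case=> i j; have /kerS[s [Ss E]] : f (M i j) = 0.
    by have /matrixP/(_ i j) := M0; rewrite !mxE.
  by have [u uE] := unitS _ Ss; exists (s, u).
exists (\prod_ij (s ij).1), (\prod_ij (s ij).2); split.
  by rewrite rmorph_prod -big_split /= big1 // => i _; case: (sP i).
apply/matrixP=> i j; rewrite !mxE (bigD1 (i, j)) //= mulrAC.
by have [_ /= ->] := sP (i, j); rewrite mul0r.
Qed.

Lemma lreg_mul0 (A : comNzRingType) (s a : A) : GRing.lreg s -> s * a = 0 -> a = 0.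
Proof. by move=> reg sa0; apply: reg; rewrite mulr0. Qed.

Lemma lreg_mulmx0 (A : comNzRingType) (s : A) (m n : nat) (M : 'M[A]_(m, n)) :
  GRing.lreg s -> s *: M = 0 -> M = 0.
Proof.
move=> reg sM0; apply/matrixP=> i j; rewrite mxE; apply: (lreg_mul0 reg).
by have /matrixP/(_ i j) := sM0; rewrite !mxE.
Qed.

Lemma lincomb_mx (A : comNzRingType) (m p : nat) (G : 'M[A]_(m, p)) v :
  lincomb (fun i => col i G) v = G *m v.
Proof.
apply/matrixP=> a b; rewrite /lincomb summxE mxE; apply: eq_bigr => i _.
by rewrite !mxE mulrC ord1.
Qed.

Lemma unit_mul0 (A : comNzRingType) (M : lmodType A) (t u : A) (x : M) :
  t * u = 1 -> t *: x = 0 -> x = 0.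
Proof. by move=> tu tx; rewrite -[x]scale1r -tu mulrC -scalerA tx scaler0. Qed.

Lemma tensor_relation_mx (A B : comNzRingType) (f : {rmorphism A -> B})
    (M : lmodType A) (p m : nat) (w : 'I_p -> M) (v : 'cV[B]_p) (H : 'M[A]_(m, p)) :
  surj (lincomb w) -> lincomb (fun i => tens f (w i)) v = 0 ->
  (forall c, lincomb w c = 0 -> H *m c = 0) -> map_mx f H *m v = 0.
Proof.
move=> wsurj /(tensor_relation wsurj) + HK.
apply: (gen_submod_min (N := [set v | map_mx f H *m v = 0])).
  split=> [|b x y /= Hx Hy]; first by rewrite /= mulmx0.
  by rewrite mulmxDr -scalemxAr Hx Hy scaler0 addr0.
by move=> _ [c [/HK Hc ->]] /=; rewrite -map_mxM Hc map_mx0.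
Qed.

(** The isomorphism with Q^e has a matrix G on the generators, with a right inverse N. With
    denominators t and t' cleared, H = t G and C = t' N, hence s = t t'. The kernel of the map M ->
    A^e given by H is torsion, which is the last clause. *)
Lemma rank_matrices (A : comNzRingType) (M : lmodType A) (e p : nat) (w : 'I_p -> M) :
  surj (lincomb w) -> has_rank M e ->
  exists (s : A) (H : 'M[A]_(e, p)) (C : 'M[A]_(p, e)),
    [/\ GRing.lreg s, H *m C = s%:M, forall c, lincomb w c = 0 -> H *m c = 0 &
      torsion_free M -> forall c, H *m c = 0 -> lincomb w c = 0].
Proof.
move=> wsurj [Q [f [locf [F [F' F'K FK']]]]].
have finj : injective f.
  move=> a b /eqP; rewrite -subr_eq0 -rmorphB => /eqP.
  case: locf => _ _ /[apply] -[s [sreg E]].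
  by apply/eqP; rewrite -subr_eq0; apply/eqP; apply: (lreg_mul0 sreg).
have unit_lreg t u : f t * u = 1 -> GRing.lreg t.
  move=> tu; apply: mulrI0_lreg => a ta0; apply: finj.
  by rewrite rmorph0 -[f a]mul1r -tu mulrAC -rmorphM ta0 rmorph0 mul0r.
have minj m n : injective (fun X : 'M_(m, n) => map_mx f X).
  move=> X Y /matrixP XY; apply/matrixP=> i j; apply: finj.
  by have := XY i j; rewrite !mxE.
pose G := \matrix_(i < e, j < p) F (tens f (w j)) i 0.
have GE v : F (lincomb (fun i => tens f (w i)) v) = G *m v.
  rewrite lincomb_linmap -lincomb_mx; apply: eq_bigr => i _; congr (_ *: _).
  by apply/matrixP=> a b; rewrite ord1 !mxE.
have /choice[N NE] : forall j : 'I_e, exists v : 'cV[Q]_p, G *m v = delta_mx j 0.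
  move=> j; have [v vE] := @tensor_gen _ _ f _ _ _ wsurj (F' (delta_mx j 0)).
  by exists v; rewrite -GE vE FK'.
have GN : G *m (\matrix_(i, j) N j i 0) = 1%:M.
  apply/matrixP=> i j; have /matrixP/(_ i 0) := NE j.
  rewrite !mxE eqxx andbT => <-.
  by apply: eq_bigr => l _; rewrite !mxE.
have [t [u [H [tu HE]]]] := loc_common_mx G locf.
have [t' [u' [C [tu' CE]]]] := loc_common_mx (\matrix_(i, j) N j i 0) locf.
have HG c : map_mx f (H *m c) = f t *: (G *m map_mx f c).
  by rewrite map_mxM -HE scalemxAl.
exists (t * t'), H, C; split.
- by apply: lregM; [apply: unit_lreg tu | apply: unit_lreg tu'].
- apply: minj; rewrite map_mxM -HE -CE -scalemxAl -scalemxAr GN scalerA.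
  by rewrite map_scalar_mx rmorphM scalemx1.
- move=> c c0; apply: minj; rewrite HG -GE -tens_lincomb c0 tens0 linear0.
  by rewrite scaler0 map_mx0.
move=> tf c Hc0.
have : lincomb (fun i => tens f (w i)) (map_mx f c) = 0.
  apply: (can_inj F'K); rewrite linear0 GE; apply: (unit_mul0 tu).
  by rewrite -HG Hc0 map_mx0.
move/(tensor_relation wsurj).
(* A relation over Q is, up to a unit [f t], the image of a relation over A; it suffices that such
   vectors form a submodule. *)
pose X := [set v | exists t u r, [/\ f t * u = 1, lincomb w r = 0 & f t *: v = map_mx f r]].
suff HX : is_submod X.
  move/(gen_submod_min (N := X)) => /(_ HX)[].
    by move=> _ [r [r0 ->]]; exists 1, 1, r; rewrite rmorph1 mulr1 scale1r.
  move=> t1 [u1 [r [tu1 r0]]]; rewrite -map_mxZ => /minj E; apply: tf.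
  by exists t1; split; [apply: unit_lreg tu1 | rewrite -linearZ E].
split.
  by exists 1, 1, 0; rewrite rmorph1 mulr1 (linear0 (lincomb w)) scaler0 map_mx0.
move=> b v1 v2 [t1 [u1 [r1 [tu1 r10 E1]]]] [t2 [u2 [r2 [tu2 r20 E2]]]].
have [t3 [u3 [tu3 b3]]] := loc_common (fun _ : 'I_1 => b) locf.
have [b' b'E] := b3 0.
exists (t3 * t1 * t2), (u3 * u1 * u2), ((b' * t2) *: r1 + (t3 * t1) *: r2); split.
- transitivity ((f t3 * u3) * (f t1 * u1) * (f t2 * u2)); last by rewrite tu3 tu1 tu2 !mulr1.
  by rewrite !rmorphM; ring.
- by rewrite linearD !linearZ /= r10 r20 !scaler0 addr0.
rewrite scalerDr map_mxD !map_mxZ !rmorphM -b'E -E1 -E2 !scalerA.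
by congr (_ *: _ + _); ring.
Qed.

(** * Cokernels of submatrices *)

Lemma inj_surj_bij (S T : Type) (f : S -> T) : injective f -> surj f -> bijective f.
Proof.
move=> finj /choice[g gK]; exists g => // x.
by apply: finj; rewrite gK.
Qed.

Lemma qproj0 (A : nzRingType) (M : lmodType A) (X : set M) (x : M) :
  is_submod X -> qproj X x = 0 <-> X x.
Proof.
by move=> HX; rewrite -(linear0 (qproj X)) qproj_eq subr0 gen_submod_id.
Qed.

Lemma lincomb_split (A : comNzRingType) (M : lmodType A) (c n : nat)
    (x : 'I_(c + n) -> M) v :
  lincomb x v = lincomb (fun j => x (lshift n j)) (usubmx v)
              + lincomb (fun j => x (rshift c j)) (dsubmx v).
Proof.
rewrite /lincomb big_split_ord /=; congr (_ + _);
  by apply: eq_bigr => i _; rewrite !mxE.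
Qed.

Lemma coker_presents (A : comNzRingType) (M : lmodType A) (c n q : nat)
    (x : 'I_(c + n) -> M) (phi : 'M[A]_(c + n, q)) (y : 'I_c -> M)
    (X := gen_submod (range y)) :
  presents phi x -> (forall j, x (lshift n j) = y j) ->
  presents (dsubmx phi) (fun i => qproj X (x (rshift c i))).
Proof.
move=> [ex xsurj] xy; have HX : is_submod X by exact: gen_submodP.
have qlow v : qproj X (lincomb x v) = lincomb (fun i => qproj X (x (rshift c i))) (dsubmx v).
  rewrite lincomb_split linearD /= [X in _ + X]lincomb_linmap /= [X in X + _ = _](_ : _ = 0) ?add0r //.
  apply/qproj0 => //; apply/gen_submod_range; exists (usubmx v).
  by apply: eq_bigr => i _; rewrite xy.
split=> [u|z]; last first.
  have [v vE] := xsurj (repr z); exists (dsubmx v).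
  by rewrite -[LHS]qlow [lincomb x v]vE qprojK.
rewrite -[\sum_(i < n) _]/(lincomb (fun i => qproj X (x (rshift c i))) u).
split=> [|[w <-]]; last first.
  rewrite mul_dsub_mx -qlow.
  have -> : lincomb x (phi *m w) = 0 by apply/ex; exists w.
  exact: linear0.
rewrite -[u in lincomb _ u](col_mxKd (0 : 'cV_c)) -qlow => /(qproj0 _ HX)/gen_submod_range[d dE].
(* A combination of the last generators that falls in the submodule is completed by - d to a
   relation among all of them. *)
have /ex[w wE] : lincomb x (col_mx (- d) u) = 0.
  rewrite lincomb_split col_mxKu col_mxKd linearN /=.
  move: dE; rewrite lincomb_split col_mxKu linear0 add0r col_mxKd => ->.
  rewrite addrC; apply/eqP; rewrite subr_eq0; apply/eqP.
  by apply: eq_bigr => i _; rewrite xy.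
by exists w; rewrite mul_dsub_mx wE col_mxKd.
Qed.

(** The bordered matrix is S times columns killed by H, where S extracts the last k + 1 rows;
    [minor_vanish] applies because c + k + 1 < (c + 1) + (k + 1). *)
Lemma bordered_det_relation (A : comNzRingType) (c k q : nat) (s : A)
    (H : 'M[A]_(c.+1, c + k.+1)) (C : 'M[A]_(c + k.+1, c.+1))
    (phi : 'M[A]_(c + k.+1, q)) (g : 'I_k -> 'I_q) (w : 'cV[A]_q) :
  GRing.lreg s -> H *m C = s%:M -> H *m phi = 0 ->
  bordered_det (mxsub (@rshift c k.+1) g phi) (dsubmx phi *m w) = 0.
Proof.
move=> sreg HC Hphi; pose S : 'M[A]_(k.+1, c + k.+1) := row_mx 0 1%:M.
have SE m (N : 'M[A]_(c + k.+1, m)) : dsubmx N = S *m N.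
  by rewrite -[in RHS](vsubmxK N) mul_row_col mul0mx mul1mx add0r.
have -> : mxsub (@rshift c k.+1) g phi = S *m colsub g phi.
  by rewrite -SE; apply/matrixP=> i j; rewrite !mxE.
rewrite /bordered_det SE -mulmxA -mul_mx_row.
apply: (minor_vanish (t := 1 + k) S sreg HC); last by rewrite addSn addnS.
rewrite mul_mx_row mulmxA mulmx_colsub Hphi mul0mx.
have -> : colsub g (0 : 'M[A]_(c.+1, q)) = 0 by apply/matrixP=> i j; rewrite !mxE.
exact: row_mx0.
Qed.

Lemma coker_minors (A : comNzRingType) (M : lmodType A) (c k q : nat)
    (x : 'I_(c + k.+1) -> M) (phi : 'M[A]_(c + k.+1, q)) (g : 'I_k -> 'I_q)
    (y : 'I_c -> M) (s : A)
    (H : 'M[A]_(c.+1, c + k.+1)) (C : 'M[A]_(c + k.+1, c.+1))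
    (psi := mxsub (@rshift c k.+1) g phi) (X := gen_submod (range y)) :
  presents phi x -> (forall j, x (lshift k.+1 j) = y j) ->
  GRing.lreg s -> H *m C = s%:M -> H *m phi = 0 ->
  exists f : {linear quotmod X -> submod (minors k psi)},
    [/\ forall v, submod_val (f (lincomb (fun i => qproj X (x (rshift c i))) v)) = bordered_det psi v,
        surj f & forall b z, minors k psi b -> f z = 0 -> b *: z = 0].
Proof.
move=> phix xy sreg HC Hphi; have [ex xsurj] := coker_presents phix xy.
have [d [dE dsurj]] := bordered_det_corestrict psi.
have [|u u0|f fE] := lift_linear (p := lincomb (fun i => qproj X (x (rshift c i)))) (h := d).
- exact: xsurj.
- have [w wE] := (ex u).1 u0; apply: submod_val_inj.
  by rewrite dE linear0 -wE (bordered_det_relation _ _ sreg HC Hphi).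
exists f; split.
- by move=> v; rewrite fE dE.
- move=> t; have [v <-] := dsurj t.
  by exists (lincomb (fun i => qproj X (x (rshift c i))) v); rewrite fE.
move=> b z Ib; have [v <-] := xsurj z; rewrite -[\sum_i _]/(lincomb _ v) fE => dv0.
have v0 : bordered_det psi v = 0 by rewrite -dE dv0 linear0.
have [w wE] := bordered_det_ker_torsion v0 Ib; rewrite -linearZ /= wE.
(* Placing the entries of w at the columns g turns psi w into the last rows of a relation of M. *)
apply/ex; exists (colsub g 1%:M *m w); rewrite mulmxA mulmx_colsub mulmx1.
by congr (_ *m _); apply/matrixP=> i j; rewrite !mxE.
Qed.

Lemma coker_iso (A : comNzRingType) (M : lmodType A) (I : set A^o)
    (f : {linear M -> submod I}) :
  surj f -> grade_ge I 1 -> torsion_free M ->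
  (forall b z, I b -> f z = 0 -> b *: z = 0) -> bijective f.
Proof.
move=> fsurj /grade_ge1P[b [Ib breg]] tf fker; apply: inj_surj_bij => // u v.
move/eqP; rewrite -subr_eq0 -linearB => /eqP fuv.
apply/eqP; rewrite -subr_eq0; apply/eqP/tf; exists b; split=> //.
exact: fker.
Qed.

(** * Generic linear combinations *)

(** Comparing coefficients, mu w_i = - beta w_(i+1): descending from the top degree costs one factor
    mu per step. The constant coefficient of the product is left free so that a nonzero constant
    product is allowed. *)
Lemma linear_poly_torsion (A : comNzRingType) (mu beta : A) (w : {poly A}) :
  (forall i, ((mu *: 'X + beta%:P) * w)`_i.+1 = 0) -> mu ^+ size w *: w = 0.
Proof.
move=> H; have step i : mu * w`_i = - (beta * w`_i.+1).
  apply/eqP; rewrite -addr_eq0; apply/eqP; rewrite -[RHS](H i).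
  by rewrite mulrDl -scalerAl coefD coefZ coefXM mulrC coefCM /= [w`_i * _]mulrC.
have desc j i : (size w <= i + j)%N -> mu ^+ j * w`_i = 0.
  elim: j i => [|j IH] i; first by rewrite addn0 => wi; rewrite nth_default // mulr0.
  rewrite addnS -addSn => /IH E.
  by rewrite exprSr -mulrA step mulrN mulrCA E mulr0 oppr0.
apply/polyP=> i; rewrite coefZ coef0.
by apply: desc; rewrite leq_addl.
Qed.

(** Pseudo-division: the leading coefficient mu may fail to be a unit, so each coefficient of u
    costs one factor mu. *)
Lemma linear_poly_division (A : comNzRingType) (mu beta : A) (u : {poly A}) :
  exists N (q : {poly A}) (rho : A),
    mu ^+ N *: u = (mu *: 'X + beta%:P) * q + rho%:P.
Proof.
elim/poly_ind: u => [|u b [N [q [rho E]]]].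
  by exists 0%N, 0, 0; rewrite scaler0 mulr0 addr0.
exists N.+1, (mu *: (q * 'X) + rho%:P), (mu ^+ N.+1 * b - rho * beta).
rewrite exprS scalerDr -scalerA scalerAl E -!mul_polyC !(polyCB, polyCM).
by ring.
Qed.

(* R[Z] is viewed as a polynomial ring in 'X_a over itself, which keeps degrees in
   'X_a accessible without naming the ring of the other variables. *)
Definition split_var (R : comNzRingType) (n : nat) (a : 'I_n) :
    {mpoly R[n]} -> {poly {mpoly R[n]}} :=
  mmap (polyC \o @mpolyC n R) (fun i => if i == a then 'X else ('X_i)%:P).

HB.instance Definition _ (R : comNzRingType) (n : nat) (a : 'I_n) :=
  GRing.RMorphism.copy (@split_var R n a) (@split_var R n a).

Lemma split_varD (R : comNzRingType) (n : nat) (a : 'I_n) (u v : {mpoly R[n]}) :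
  split_var a (u + v) = split_var a u + split_var a v.
Proof. exact: (rmorphD (split_var a)). Qed.

Lemma split_varM (R : comNzRingType) (n : nat) (a : 'I_n) (u v : {mpoly R[n]}) :
  split_var a (u * v) = split_var a u * split_var a v.
Proof. exact: (rmorphM (split_var a)). Qed.

Lemma split_var0 (R : comNzRingType) (n : nat) (a : 'I_n) :
  split_var a (0 : {mpoly R[n]}) = 0.
Proof. exact: (rmorph0 (split_var a)). Qed.

Lemma split_varC (R : comNzRingType) (n : nat) (a : 'I_n) (b : R) :
  split_var a b%:MP = (b%:MP)%:P.
Proof. by rewrite /split_var mmapC. Qed.

Lemma split_varX (R : comNzRingType) (n : nat) (a i : 'I_n) :
  split_var a ('X_i : {mpoly R[n]}) = if i == a then 'X else ('X_i)%:P.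
Proof. by rewrite /split_var mmapX mmap1U. Qed.

Lemma split_varK (R : comNzRingType) (n : nat) (a : 'I_n) (u : {mpoly R[n]}) :
  (split_var a u).['X_a] = u.
Proof.
rewrite /split_var /mmap horner_sum [RHS]mpolyE; apply: eq_bigr => m _.
rewrite /= hornerM hornerC -mul_mpolyC; congr (_ * _).
rewrite /mmap1 horner_prod [RHS]mpolyXE_id; apply: eq_bigr => i _.
rewrite horner_exp; congr (_ ^+ _).
by case: eqP => [->|_]; rewrite ?hornerX ?hornerC.
Qed.

Definition free_of (R : comNzRingType) (n : nat) (a : 'I_n) (u : {mpoly R[n]}) :=
  split_var a u = u%:P.

Lemma linear_mpoly_torsion (R : comNzRingType) (n : nat) (a : 'I_n)
    (mu beta u : {mpoly R[n]}) :
  free_of a mu -> free_of a beta -> (mu * 'X_a + beta) * u = 0 ->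
  exists N, mu ^+ N * u = 0.
Proof.
move=> fmu fbeta /(congr1 (split_var a)).
rewrite split_varM split_varD split_varM split_varX eqxx fmu fbeta split_var0 mul_polyC => E.
exists (size (split_var a u)).
have := @linear_poly_torsion _ mu beta (split_var a u).
rewrite E => /(_ (fun i => coef0 _ i.+1)) /(congr1 (horner^~ 'X_a)) /=.
by rewrite hornerZ split_varK horner0.
Qed.

(** Let f = mu 'X_a + beta and pseudo-divide: mu^N u1 = f q + rho. Then f (mu^N u2 - f2 q) = f2 rho
    is constant in 'X_a, so a power of mu kills the second factor, hence f2 rho, and by [reg2] a
    power of mu kills rho. *)
Lemma linear_mpoly_pair (R : comNzRingType) (n : nat) (a : 'I_n)
    (mu beta f2 u1 u2 : {mpoly R[n]}) :
  free_of a mu -> free_of a beta -> free_of a f2 ->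
  (forall u, f2 * u = 0 -> exists N, mu ^+ N * u = 0) ->
  (mu * 'X_a + beta) * u2 = f2 * u1 ->
  exists N q, mu ^+ N * u1 = (mu * 'X_a + beta) * q.
Proof.
move=> fmu fbeta ff2 reg2 /(congr1 (split_var a)).
rewrite !split_varM split_varD split_varM split_varX eqxx fmu fbeta ff2 mul_polyC.
set f := mu *: 'X + _ => E.
have [N [q [rho qE]]] := linear_poly_division mu beta (split_var a u1).
pose w := mu ^+ N *: split_var a u2 - f2 *: q.
have fw : f * w = (f2 * rho)%:P.
  rewrite mulrBr -scalerAr E -scalerAr -[f2 *: _]mul_polyC scalerAr qE polyCM.
  by rewrite /f; ring.
have w0 : mu ^+ size w *: w = 0.
  by apply: (@linear_poly_torsion _ mu beta) => i; rewrite fw coefC.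
have [N' rho0] : exists N', mu ^+ N' * (mu ^+ size w * rho) = 0.
  apply: reg2; apply: polyC_inj; rewrite mulrCA polyCM -fw mulrCA mul_polyC w0.
  by rewrite mulr0.
exists (N' + size w + N)%N, (mu ^+ (N' + size w) * q.['X_a]).
have := congr1 (horner^~ 'X_a) qE; rewrite /= hornerZ split_varK hornerD hornerM hornerC.
rewrite /f hornerD hornerZ hornerX hornerC exprD -mulrA => ->.
by rewrite mulrDr [in X in _ + X]exprD -[X in _ + X]mulrA rho0 addr0 mulrCA.
Qed.

(** * Radicals of colon ideals *)

(** b lies in the radical of the colon ideal (s) : y. *)
Definition colon_rad (B : comNzRingType) (s y b : B) : Prop :=
  exists N d, b ^+ N * y = s * d.

Lemma colon_radD (B : comNzRingType) (s y b1 b2 : B) :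
  colon_rad s y b1 -> colon_rad s y b2 -> colon_rad s y (b1 + b2).
Proof.
move=> [N1 [d1 E1]] [N2 [d2 E2]].
have pow b N d i : b ^+ N * y = s * d -> (N <= i)%N -> exists d', b ^+ i * y = s * d'.
  move=> E Ni; exists (b ^+ (i - N) * d).
  by rewrite -{1}(subnK Ni) exprD -mulrA E mulrCA.
have term (i : 'I_(N1 + N2).+1) :
    exists d, (b1 ^+ (N1 + N2 - i) * b2 ^+ i) *+ 'C(N1 + N2, i) * y = s * d.
  have [/(pow _ _ _ _ E2)[d dE]|lti] := leqP N2 i.
    exists ((b1 ^+ (N1 + N2 - i) * d) *+ 'C(N1 + N2, i)).
    by rewrite mulrnAl -mulrA dE mulrCA mulrnAr.
  have /(pow _ _ _ _ E1)[d dE] : (N1 <= N1 + N2 - i)%N by rewrite -addnBA ?leq_addr // ltnW.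
  exists ((b2 ^+ i * d) *+ 'C(N1 + N2, i)).
  by rewrite mulrnAl mulrAC dE -mulrA [d * _]mulrC mulrnAr.
have /choice[d dE] := term.
exists (N1 + N2)%N, (\sum_i d i); rewrite exprDn mulr_suml mulr_sumr.
by apply: eq_bigr => i _; rewrite dE.
Qed.

Lemma colon_radM (B : comNzRingType) (s y b c : B) :
  colon_rad s y b -> colon_rad s y (c * b).
Proof.
move=> [N [d E]]; exists N, (c ^+ N * d).
by rewrite exprMn -mulrA E mulrCA.
Qed.

Lemma colon_rad0 (B : comNzRingType) (s y : B) : colon_rad s y 0.
Proof. by exists 1%N, 0; rewrite expr1 mul0r mulr0. Qed.

Lemma colon_radX (B : comNzRingType) (s y b : B) N :
  colon_rad s y (b ^+ N) -> colon_rad s y b.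
Proof. by move=> [N' [d E]]; exists (N * N')%N, d; rewrite exprM. Qed.

(** Up to powers of mu, f1 and f2 form a regular pair. [Sat] is divisibility by s up to such powers;
    [step] strips one factor f1 and one factor f2 at once, and a double induction strips the powers
    of both. *)
Lemma colon_rad_pair (B : comNzRingType) (s y mu f1 f2 : B) :
  GRing.lreg s ->
  (forall u, f1 * u = 0 -> exists N, mu ^+ N * u = 0) ->
  (forall u1 u2, f2 * u1 = f1 * u2 -> exists N d, mu ^+ N * u1 = f1 * d) ->
  colon_rad s y f1 -> colon_rad s y f2 -> colon_rad s y mu.
Proof.
move=> sreg tors pair [N1 E1] [N2 E2].
pose Sat z := exists N d, mu ^+ N * z = s * d.
have SatM b z : Sat z -> Sat (b * z).
  by move=> [N [d E]]; exists N, (b * d); rewrite mulrCA E mulrCA.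
have step z : Sat (f1 * z) -> Sat (f2 * z) -> Sat z.
  move=> [M1 [d1 F1]] [M2 [d2 F2]].
  have [|M [d dE]] := pair (mu ^+ M2 * d1) (mu ^+ M1 * d2).
    apply: sreg; transitivity (mu ^+ M2 * f2 * (s * d1)); first by ring.
    transitivity (mu ^+ M1 * f1 * (s * d2)); last by ring.
    by rewrite -F1 -F2; ring.
  have [|M' M'E] := tors (mu ^+ M * mu ^+ M1 * mu ^+ M2 * z - s * d).
    transitivity (mu ^+ M * mu ^+ M2 * (mu ^+ M1 * (f1 * z)) - s * (f1 * d)); first by ring.
    by rewrite F1 -dE; ring.
  exists (M' + M + M1 + M2)%N, (mu ^+ M' * d); apply/eqP; rewrite -subr_eq0 -M'E !exprD.
  by apply/eqP; ring.
have pow2 n z : Sat (f1 * z) -> Sat (f2 ^+ n * z) -> Sat z.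
  elim: n z => [|n IH] z S1; first by rewrite mul1r.
  move=> S2; apply: IH => //; apply: step; last by rewrite mulrA -exprS.
  by rewrite mulrCA; apply: SatM.
have pow1 n z : Sat (f1 ^+ n * z) -> Sat (f2 ^+ N2 * z) -> Sat z.
  elim: n z => [|n IH] z; first by rewrite mul1r.
  move=> S1 S2; apply: IH => //; apply: (pow2 N2); first by rewrite mulrA -exprS.
  by rewrite mulrCA; apply: SatM.
by apply: (pow1 N1); exists 0%N; rewrite mul1r; [exact: E1 | exact: E2].
Qed.

(** The conditions on f1 and f2 are imposed in A, where degrees in a variable are available;
    clearing denominators carries them to B. *)
Lemma colon_rad_loc (A B : comNzRingType) (S : set A) (f : {rmorphism A -> B})
    (s y : B) (mu f1 f2 : A) :
  is_localization S f -> GRing.lreg s ->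
  (forall u, f1 * u = 0 -> exists N, mu ^+ N * u = 0) ->
  (forall u1 u2, f1 * u2 = f2 * u1 -> exists N q, mu ^+ N * u1 = f1 * q) ->
  colon_rad s y (f f1) -> colon_rad s y (f f2) -> colon_rad s y (f mu).
Proof.
move=> [unitS fracS kerS] sreg tors pair; apply: colon_rad_pair => //.
  move=> u fu0; have [a [t [/unitS[t' tt'] uE]]] := fracS u.
  have /kerS[t1 [/unitS[t1' tt1'] E]] : f (f1 * a) = 0.
    by rewrite rmorphM -uE mulrA fu0 mul0r.
  have [|N NE] := tors (t1 * a); first by rewrite mulrCA.
  exists N; rewrite -[LHS]mulr1 -tt' -[LHS]mulr1 -tt1'.
  transitivity (f mu ^+ N * (f t1 * (u * f t)) * (t' * t1')); first by ring.
  by rewrite uE -rmorphXn -!rmorphM NE rmorph0 mul0r.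
move=> u1 u2 E12.
have [a1 [t1 [/unitS[t1' tt1'] u1E]]] := fracS u1.
have [a2 [t2 [/unitS[t2' tt2'] u2E]]] := fracS u2.
have /kerS[t3 [/unitS[t3' tt3'] E3]] : f (f1 * (a2 * t1) - f2 * (a1 * t2)) = 0.
  rewrite rmorphB !rmorphM -u1E -u2E.
  transitivity ((f f1 * u2 - f f2 * u1) * (f t1 * f t2)); first by ring.
  by rewrite E12 subrr mul0r.
have [|N [q qE]] := pair (t3 * (a1 * t2)) (t3 * (a2 * t1)).
  by apply/eqP; rewrite -subr_eq0 !(mulrCA _ t3) -mulrBr E3.
exists N, (f q * (t1' * t2' * t3')).
have -> : f mu ^+ N * u1 =
    f mu ^+ N * (f t3 * (u1 * f t1 * f t2)) * (t1' * t2' * t3').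
  transitivity (f mu ^+ N * u1 * (f t1 * t1') * (f t2 * t2') * (f t3 * t3')); last by ring.
  by rewrite tt1' tt2' tt3' !mulr1.
by rewrite u1E -rmorphXn -!rmorphM qE rmorphM; ring.
Qed.

(** * Determinants with generic rows *)

Definition subst_row (A : comNzRingType) (n : nat) (l0 : 'I_n) (M : 'M[A]_n)
  (v : 'rV[A]_n) : 'M[A]_n := \matrix_(l, p) if l == l0 then v 0 p else M l p.

Lemma det_subst_row (A : comNzRingType) (n : nat) (l0 : 'I_n) (M : 'M[A]_n) b u v :
  \det (subst_row l0 M (b *: u + v)) =
  b * \det (subst_row l0 M u) + \det (subst_row l0 M v).
Proof.
rewrite -[X in _ = _ + X]mul1r; apply: (@determinant_multilinear _ _ _ _ _ l0).
- by apply/matrixP=> i j; rewrite !mxE eqxx mul1r.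
- by apply/matrixP=> i j; rewrite !mxE eq_sym (negPf (neq_lift _ _)).
- by apply/matrixP=> i j; rewrite !mxE eq_sym (negPf (neq_lift _ _)).
Qed.

Lemma free_of_det (R : comNzRingType) (n N : nat) (a : 'I_n) (M : 'M[{mpoly R[n]}]_N) :
  (forall i j, free_of a (M i j)) -> free_of a (\det M).
Proof.
move=> fM; rewrite /free_of -det_map_mx -det_map_mx; congr (\det _).
by apply/matrixP=> i j; rewrite [LHS]mxE [RHS]mxE; exact: fM.
Qed.

Lemma free_of_sum (R : comNzRingType) (n : nat) (a : 'I_n) (I : finType)
    (P : pred I) (F : I -> {mpoly R[n]}) :
  (forall i, P i -> free_of a (F i)) -> free_of a (\sum_(i | P i) F i).
Proof.
move=> fF; elim/big_ind: _ => //; first by rewrite /free_of split_var0.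
by move=> u v fu fv; rewrite /free_of split_varD fu fv polyCD.
Qed.

Lemma free_ofCX (R : comNzRingType) (n : nat) (a i : 'I_n) (b : R) :
  i != a -> free_of a (b%:MP * 'X_i : {mpoly R[n]}).
Proof.
by move=> ia; rewrite /free_of split_varM split_varC split_varX (negPf ia) polyCM.
Qed.

Lemma mxvec_index_inj (m n : nat) (i i' : 'I_m) (j j' : 'I_n) :
  mxvec_index i j = mxvec_index i' j' -> i = i' /\ j = j'.
Proof. by move/cast_ord_inj/enum_rank_inj => [-> ->]. Qed.

Section GenericDeterminants.
Variables (R : comNzRingType) (r c : nat) (alpha : 'M[R]_(r, c.+1)).
Local Notation P := {mpoly R[r * c]}.

(** With the coordinates of a_i in row i of alpha, these are the coordinates of the generic element
    x_j over R[Z]. *)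
Definition gen_row (j : 'I_c) : 'rV[P]_c.+1 :=
  \row_p \sum_i (alpha i p)%:MP * 'X_(mxvec_index i j).

Definition const_row (i : 'I_r) : 'rV[P]_c.+1 := \row_p (alpha i p)%:MP.

(* Row l is generic for l < t. There are only c generic rows, so row c is
   constant whatever t; this is what [insub] encodes. *)
Definition mixed_mx (t : nat) (i : 'I_c.+1 -> 'I_r) : 'M[P]_c.+1 :=
  \matrix_(l, p) if insub (val l) is Some j then
                   if (l < t)%N then gen_row j 0 p else const_row (i l) 0 p
                 else const_row (i l) 0 p.

Definition gen_row_without (j : 'I_c) (i0 : 'I_r) : 'rV[P]_c.+1 :=
  \row_p \sum_(i | i != i0) (alpha i p)%:MP * 'X_(mxvec_index i j).

Lemma gen_rowE j i0 :
  gen_row j = 'X_(mxvec_index i0 j) *: const_row i0 + gen_row_without j i0.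
Proof.
apply/matrixP=> a p; rewrite !mxE (bigD1 i0) //=; congr (_ + _).
exact: mulrC.
Qed.

Section Step.
Variables (j : 'I_c) (i : 'I_c.+1 -> 'I_r).
Let l0 : 'I_c.+1 := widen_ord (leqnSn c) j.

Lemma mixed_mxS : mixed_mx j.+1 i = subst_row l0 (mixed_mx j i) (gen_row j).
Proof.
apply/matrixP=> l p; rewrite !mxE; case: eqVneq => [->|ll0] /=.
  by rewrite ltnSn (valK j : insub (nat_of_ord j) = Some j) mxE.
have lj : (l < j.+1)%N = (l < j)%N.
  by rewrite ltnS leq_eqVlt; case: eqP => // lj; case/eqP: ll0; apply: val_inj.
by rewrite lj.
Qed.

Lemma mixed_mx_row : mixed_mx j i = subst_row l0 (mixed_mx j i) (const_row (i l0)).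
Proof.
apply/matrixP=> l p; rewrite [RHS]mxE; case: eqVneq => // ->.
by rewrite mxE /= ltnn; case: insub.
Qed.

Lemma mixed_mx_entry_free l p i' : free_of (mxvec_index i' j) (mixed_mx j i l p).
Proof.
have fC : free_of (mxvec_index i' j) (const_row (i l) 0 p).
  by rewrite mxE /free_of split_varC.
rewrite mxE; case: insubP => //= j' _ j'l; case: ltnP => // lj.
rewrite mxE; apply: free_of_sum => i1 _; apply: free_ofCX.
apply/eqP => /mxvec_index_inj[_ jj]; move: lj; rewrite -j'l jj ltnn //.
Qed.

Lemma gen_row_without_free i0 p :
  free_of (mxvec_index i0 j) (gen_row_without j i0 0 p).
Proof.
rewrite mxE; apply: free_of_sum => i1 ii; apply: free_ofCX.
by apply/eqP => /mxvec_index_inj[E _]; rewrite E eqxx in ii.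
Qed.

Lemma subst_row_free (i0 : 'I_r) (v : 'rV[P]_c.+1) :
  (forall p, free_of (mxvec_index i0 j) (v 0 p)) ->
  free_of (mxvec_index i0 j) (\det (subst_row l0 (mixed_mx j i) v)).
Proof.
move=> fv; apply: free_of_det => l p; rewrite mxE.
by case: eqP => // _; apply: mixed_mx_entry_free.
Qed.

(** Row j is linear in z_(i(j), j), with coefficient the constant row i(j); so the leading
    coefficient mu is the determinant with one generic row fewer. *)
Lemma mixed_det_linear :
  \det (mixed_mx j.+1 i) =
  \det (mixed_mx j i) * 'X_(mxvec_index (i l0) j)
    + \det (subst_row l0 (mixed_mx j i) (gen_row_without j (i l0))).
Proof.
by rewrite mixed_mxS (gen_rowE j (i l0)) det_subst_row -mixed_mx_row mulrC.
Qed.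

Lemma mixed_det_free : free_of (mxvec_index (i l0) j) (\det (mixed_mx j i)).
Proof. by apply: free_of_det => l p; apply: mixed_mx_entry_free. Qed.

(** Row l1 is the constant row of index [i l1], so the part of row j that carries this variable
    contributes a determinant with two equal rows. *)
Lemma mixed_det_alt_free (l1 : 'I_c.+1) :
  l0 != l1 -> (j <= l1)%N -> free_of (mxvec_index (i l1) j) (\det (mixed_mx j.+1 i)).
Proof.
move=> l01 jl1; rewrite mixed_mxS (gen_rowE j (i l1)) det_subst_row.
rewrite [X in _ * X + _](determinant_alternate l01) ?mulr0 ?add0r.
  by apply: subst_row_free => p; apply: gen_row_without_free.
move=> p; rewrite !mxE eqxx [l1 == _]eq_sym (negPf l01) ltnNge jl1 /=.
by case: insub => [?|]; rewrite ?mxE.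
Qed.

End Step.

(** The second determinant comes from exchanging the constants of rows j and j + 1, which turns mu
    into - mu and brings in another variable. Row j + 1 always exists and is constant, since there
    are c + 1 rows and only c generic ones. *)
Lemma generic_step (B : comNzRingType) (S : set P) (f : {rmorphism P -> B}) (s y : B)
    (j : 'I_c) :
  is_localization S f -> GRing.lreg s ->
  (forall i, colon_rad s y (f (\det (mixed_mx j.+1 i)))) ->
  forall i, colon_rad s y (f (\det (mixed_mx j i))).
Proof.
move=> locf sreg IH i.
pose l0 : 'I_c.+1 := widen_ord (leqnSn c) j.
pose l1 : 'I_c.+1 := fintype.lift ord0 j.
have l01 : l0 != l1 by rewrite -val_eqE /= neq_ltn ltnSn.
pose i' := i \o tperm l0 l1.
have i'0 : i' l0 = i l1 by rewrite /i' /= tpermL.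
have i'1 : i' l1 = i l0 by rewrite /i' /= tpermR.
have swap : \det (mixed_mx j i') = - \det (mixed_mx j i).
  have -> : mixed_mx j i' = row_perm (tperm l0 l1) (mixed_mx j i).
    apply/matrixP=> l p; rewrite [RHS]mxE.
    have [ll0|ll0] := eqVneq l l0.
      rewrite ll0 tpermL !mxE /= ltnn ltnNge leqW //= i'0.
      by case: insub => [?|]; case: insub => [?|]; rewrite ?mxE.
    have [ll1|ll1] := eqVneq l l1.
      rewrite ll1 tpermR !mxE /= ltnn ltnNge leqW //= i'1.
      by case: insub => [?|]; case: insub => [?|]; rewrite ?mxE.
    have tl : tperm l0 l1 l = l by rewrite tpermD // eq_sym.
    by rewrite tl !mxE /i' /= tl.
  by rewrite row_permE det_mulmx det_perm odd_tperm l01 expr1 mulN1r.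
(* If the two indices agree, rows j and j + 1 are equal and mu = 0. *)
have [i01|i01] := eqVneq (i l0) (i l1).
  have -> : \det (mixed_mx j i) = 0; last by rewrite rmorph0; apply: colon_rad0.
  apply: (determinant_alternate l01) => p; rewrite !mxE /= ltnn ltnNge leqW //=.
  by case: insub => [?|]; case: insub => [?|]; rewrite ?mxE i01.
apply: (colon_rad_loc locf sreg _ _ (IH i) (IH i')).
  move=> u; rewrite mixed_det_linear; apply: linear_mpoly_torsion.
    exact: mixed_det_free.
  by apply: subst_row_free => p; apply: gen_row_without_free.
move=> u1 u2; rewrite mixed_det_linear; apply: linear_mpoly_pair.
- exact: mixed_det_free.
- by apply: subst_row_free => p; apply: gen_row_without_free.
- by rewrite -/l0 -i'1; apply: mixed_det_alt_free => //=; rewrite leqW.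
move=> u; rewrite mixed_det_linear.
move=> /(linear_mpoly_torsion (mixed_det_free j i'))[|N].
  by apply: subst_row_free => p; apply: gen_row_without_free.
rewrite swap exprNn -mulrA => E; exists N.
by rewrite -[LHS]mul1r -(sqrr_sign _ N) -mulrA E mulr0.
Qed.

Lemma generic_descent (B : comNzRingType) (S : set P) (f : {rmorphism P -> B}) (s y : B) :
  is_localization S f -> GRing.lreg s ->
  (forall i, colon_rad s y (f (\det (mixed_mx c i)))) ->
  forall i, colon_rad s y (f (\det (mixed_mx 0 i))).
Proof.
move=> locf sreg.
suff desc t : (t <= c)%N -> (forall i, colon_rad s y (f (\det (mixed_mx t i)))) ->
    forall i, colon_rad s y (f (\det (mixed_mx 0 i))) by exact: desc.
elim: t => // t IH tc Ht; apply: IH => [|i]; first exact: ltnW.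
exact: (@generic_step _ _ _ s y (Ordinal tc) locf sreg).
Qed.
End GenericDeterminants.

(** * Reductions and Fitting ideals *)

(* A linear form h on E induces an R-algebra map S(E) -> R killing the torsion;
   through it the reduction equation reads h(E)^(s+1) <= h(U) R. *)
Lemma reduction_linear_form (R : comNzRingType) (E : lmodType R) (r : nat)
    (a : 'I_r -> E) (Q : set R^o) (h : {linear E -> R^o}) :
  is_reduction (gen_submod (range a)) -> is_ideal Q ->
  (forall (b : R) N, Q (b ^+ N) -> Q b) ->
  (forall i, Q (h (a i))) -> forall x, Q (h x).
Proof.
move=> [_ [T [rho [[S [sigma [p [sym psurj pker rhoE]]]] [s redE]]]]] Qid Qrad Qa x.
have [g [gE _]] := sym R^o h.
have gtors t : torsion t -> g t = 0.
  move=> [b [breg bt0]]; apply: breg; rewrite mulr0.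
  by rewrite -[LHS]/(b *: g t) -linearZ bt0 linear0.
have QU u : gen_submod (range a) u -> Q (h u).
  apply: (gen_submod_min (N := [set u | Q (h u)])).
    split=> [|b u1 u2 /= Q1 Q2]; first by rewrite /= linear0; case: Qid.
    by rewrite linearP; case: Qid => _; apply.
  by move=> _ [i _ <-] /=.
(* As g kills the kernel of p, this is the preimage of Q under the induced map T -> R. *)
pose W := [set t : T | exists z, p z = t /\ Q (g z)].
have HW : is_submod W.
  split; first by exists 0; rewrite !linear0; split=> //; case: Qid.
  move=> b _ _ [z1 [<- Q1]] [z2 [<- Q2]]; exists (b *: z1 + z2).
  by rewrite !linearP; split=> //; case: Qid => _; apply.
have : rees_deg rho s.+1 (\prod_(i < s.+1) rho x).
  by apply: gen_submod_in; exists (fun=> x).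
rewrite redE => /(gen_submod_min HW)[].
  move=> _ [u [y [Uu _ ->]]]; have [z zE] := psurj y.
  exists (sigma u * z); split.
    by rewrite rhoE -zE; exact: (rmorphM p).
  have -> : g (sigma u * z) = g z * h u by rewrite -gE mulrC; exact: (rmorphM g).
  by apply: ideal_mul Qid (QU _ Uu).
move=> z [zE Qz]; apply: (Qrad _ s.+1).
suff <- : g z = h x ^+ s.+1 by [].
have : g (z - sigma x ^+ s.+1) = 0.
  apply/gtors/pker.
  have -> : p (z - sigma x ^+ s.+1) = p z - p (sigma x) ^+ s.+1.
    by rewrite -(rmorphXn p); exact: (rmorphB p).
  by rewrite zE -rhoE prodr_const card_ord subrr.
have -> : g (z - sigma x ^+ s.+1) = g z - g (sigma x) ^+ s.+1.
  by rewrite -(rmorphXn g); exact: (rmorphB g).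
by rewrite gE => /eqP; rewrite subr_eq0 => /eqP.
Qed.

Lemma increasing_complement (p e : nat) (f : 'I_(p - e) -> 'I_p) :
  (e <= p)%N -> {homo f : i j / (i < j)%N} ->
  exists L : 'I_e -> 'I_p, injective L /\ forall i l, f i != L l.
Proof.
move=> ep fh; have finj : injective f.
  move=> i j fij; case: (ltngtP i j) => [/fh|/fh|/val_inj //]; by rewrite fij ltnn.
pose A := finset.setC [set f i | i : 'I_(p - e)]%SET.
have cA : #|A| = e.
  rewrite finset.cardsCs finset.setCK finset.card_imset // !card_ord subKn //.
pose L l := enum_val (cast_ord (esym cA) l).
exists L; split=> [l l' /enum_val_inj/cast_ord_inj //|i l].
have := enum_valP (cast_ord (esym cA) l); rewrite -/(L l) finset.in_setC.
by apply: contra => /eqP <-; apply: finset.imset_f.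
Qed.

(* Cramer's rule: where a (p-e)-minor delta is invertible, the module is free on
   the generators indexed by the complementary rows L. *)
Lemma fitting_coordinates (A : comNzRingType) (e p q : nat) (s : A)
    (H : 'M[A]_(e, p)) (C : 'M[A]_(p, e)) (Phi : 'M[A]_(p, q))
    (f : 'I_(p - e) -> 'I_p) (g : 'I_(p - e) -> 'I_q)
    (delta := \det (mxsub f g Phi)) :
  (e <= p)%N -> GRing.lreg s -> H *m C = s%:M -> H *m Phi = 0 ->
  {homo f : i j / (i < j)%N} ->
  exists (Th : 'M[A]_(e, p)) (L : 'I_e -> 'I_p),
    (forall u : 'cV_p, H *m u = 0 -> Th *m u = 0) /\
    colsub L Th = (delta ^+ 2)%:M.
Proof.
move=> ep sreg HC HPhi fh; have [L [Linj fL]] := increasing_complement ep fh.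
pose Pg := colsub g Phi; pose Pf := mxsub f g Phi.
pose Sf : 'M[A]_(p - e, p) := rowsub f 1%:M.
pose SL : 'M[A]_(e, p) := rowsub L 1%:M.
have SfP : Sf *m Pg = Pf.
  by rewrite /Sf mul_rowsub_mx mul1mx; apply/matrixP=> i j; rewrite !mxE.
(* Where delta is invertible, this is delta times the projection onto the generators L along the
   columns g of Phi. *)
pose Th := delta *: SL - SL *m Pg *m \adj Pf *m Sf.
(* The determinant below only shows that delta kills Th u; this second factor explains delta^2. *)
exists (delta *: Th), L; split=> [u Hu|].
  rewrite -scalemxAl; apply/row_matrixP => l; rewrite row0 linearZ /= row_mul.
  pose Sl : 'M[A]_(1, p) := row l SL.
  have Thl : row l Th *m u = delta *: (Sl *m u) - Sl *m Pg *m \adj Pf *m Sf *m u.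
    rewrite /Th linearB /= linearZ /= !row_mul mulmxBl -scalemxAl //.
  (* Pf bordered by a row of index in L and by the column u: a minor of [Phi | u], whose columns are
     all killed by H. *)
  pose B := block_mx Pf (Sf *m u) (Sl *m Pg) (Sl *m u).
  have BE : B = col_mx Sf Sl *m row_mx Pg u by rewrite mul_col_row SfP.
  have B0 : \det B = 0.
    rewrite BE; apply: (minor_vanish (t := (p - e) + 1) _ sreg HC).
      rewrite mul_mx_row Hu mulmx_colsub HPhi.
      have -> : colsub g (0 : 'M[A]_(e, q)) = 0 by apply/matrixP=> i j; rewrite !mxE.
      exact: row_mx0.
    by rewrite addnA subnKC // addn1.
  have : B *m block_mx 1%:M (- (\adj Pf *m Sf *m u)) 0 delta%:M =
         block_mx Pf 0 (Sl *m Pg) (row l Th *m u).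
    rewrite mulmx_block !mulmx1 !mulmx0 !addr0 !mulmxN !mul_mx_scalar Thl.
    congr block_mx; last by rewrite addrC !mulmxA.
    by rewrite !mulmxA mul_mx_adj mul_scalar_mx -scalemxAl addrC subrr.
  move=> /(congr1 determinant); rewrite det_mulmx B0 mul0r det_lblock.
  rewrite det_mx11 => E; apply/matrixP=> i j; rewrite !ord1 mxE [RHS]mxE.
  by rewrite -/delta in E; rewrite -E.
have SfL : colsub L Sf = 0.
  by apply/matrixP=> i j; rewrite !mxE (negPf (fL _ _)).
have SLL : colsub L SL = 1%:M.
  by apply/matrixP=> i j; rewrite !mxE (inj_eq Linj).
have -> : colsub L (delta *: Th) = delta *: (delta *: colsub L SL - SL *m Pg *m \adj Pf *m colsub L Sf).
  by rewrite mulmx_colsub; apply/matrixP=> i j; rewrite !mxE.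
by rewrite SfL SLL mulmx0 subr0 !scale_scalar_mx mulr1.
Qed.

Lemma colon_rad_ideal (A B : comNzRingType) (f : {rmorphism A -> B}) (s y : B) :
  is_ideal ([set b | colon_rad s y (f b)] : set A^o).
Proof.
split=> [|b u v /= Qu Qv]; first by rewrite /= rmorph0; apply: colon_rad0.
by rewrite rmorphD rmorphM; apply: colon_radD => //; apply: colon_radM.
Qed.

(** The determinant is a linear form in each row, so [reduction_linear_form] frees the rows one at a
    time; t counts those already arbitrary. *)
Lemma reduction_det (R : comNzRingType) (E : lmodType R) (r n : nat)
    (a : 'I_r -> E) (Q : set R^o) (theta : {linear E -> 'cV[R]_n}) :
  is_reduction (gen_submod (range a)) -> is_ideal Q ->
  (forall (b : R) N, Q (b ^+ N) -> Q b) ->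
  (forall i : 'I_n -> 'I_r, Q (\det (\matrix_(l, p) theta (a (i l)) p 0))) ->
  forall y : 'I_n -> E, Q (\det (\matrix_(l, p) theta (y l) p 0)).
Proof.
move=> red Qid Qrad Qa.
suff step t : (t <= n)%N -> forall y : 'I_n -> E,
    (forall l : 'I_n, (t <= l)%N -> exists i, y l = a i) ->
    Q (\det (\matrix_(l, p) theta (y l) p 0)).
  by move=> y; apply: (step n) => // l; rewrite leqNgt ltn_ord.
elim: t => [|t IH] tn y ya.
  have /choice[i iE] : forall l, exists i, y l = a i by move=> l; apply: ya.
  by have := Qa i; congr (Q (\det _)); apply/matrixP=> l p; rewrite !mxE iE.
pose l0 := Ordinal tn; pose M := \matrix_(l, p) theta (y l) p 0.
pose h x : R^o := \det (subst_row l0 M (theta x)^T).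
have hlin : linear h.
  by move=> b u v; rewrite /h linearP linearP /= det_subst_row.
pose hM := GRing.isLinear.Build _ _ _ _ h hlin.
pose h' : {linear E -> R^o} := HB.pack h hM.
have hE x : h x = \det (\matrix_(l, p) theta (if l == l0 then x else y l) p 0).
  by congr (\det _); apply/matrixP=> l p; rewrite !mxE; case: eqP.
have -> : \matrix_(l, p) theta (y l) p 0 =
    \matrix_(l, p) theta (if l == l0 then y l0 else y l) p 0.
  by apply/matrixP=> l p; rewrite !mxE; case: eqP => [->|].
rewrite -hE; apply: (reduction_linear_form (h := h') red Qid Qrad) => i.
rewrite -[h' (a i)]/(h (a i)) hE; apply: IH => [|l tl]; first exact: ltnW.
case: eqVneq => [_|ll0]; first by exists i.
apply: ya; rewrite ltn_neqAle tl andbT.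
by apply: contra ll0 => /eqP tl'; apply/eqP/val_inj.
Qed.

Lemma fitting_colon_rad (R R2 : comNzRingType) (r c : nat) (E : lmodType R)
    (a : 'I_r -> E) (loc : {rmorphism {mpoly R[r * c]} -> R2})
    (S : set {mpoly R[r * c]}) (s : R2) (v : tensor (nagata_map loc) E)
    (d : 'cV[R2]_c) (b : R) (j : 'I_c) :
  is_localization S loc -> has_rank E c.+1 ->
  is_reduction (gen_submod (range a)) -> GRing.lreg s ->
  s *: v = lincomb (generic_elt loc a) d -> fitting E c.+1 b ->
  colon_rad s (d j 0) (nagata_map loc b).
Proof.
move=> locS Erank red sreg svE [p [q [Phi [w [[ew wsurj] bPhi]]]]].
pose Q : set R^o := [set b | colon_rad s (d j 0) (nagata_map loc b)].
have Qid : is_ideal Q := colon_rad_ideal _ _ _.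
have Qrad (b' : R) N : Q (b' ^+ N) -> Q b'.
  by move=> QbN; apply: (@colon_radX _ _ _ _ N); rewrite -(rmorphXn (nagata_map loc)).
suff minQ : minors (p - c.+1) Phi `<=` Q by exact: minQ.
apply: gen_submod_min => // _ [f [g [fh gh ->]]].
have [s0 [H [C [s0reg HC HK _]]]] := rank_matrices wsurj Erank.
have cp : (c.+1 <= p)%N.
  rewrite leqNgt; apply/negP => pc.
  have /eqP := det_mulmx_wide H C pc; rewrite HC det_scalar.
  exact/negP/(lreg_neq0 (lregX s0reg)).
have HPhi : H *m Phi = 0.
  apply/matrixP=> i l; have : H *m (Phi *m delta_mx l (0 : 'I_1)) = 0.
    by apply/HK/ew; exists (delta_mx l 0).
  by rewrite mulmxA -colE => /matrixP/(_ i 0); rewrite !mxE.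
have [Th [L [ThK ThL]]] := @fitting_coordinates _ _ _ _ s0 H C Phi f g cp s0reg HC HPhi fh.
have [u u0|theta thetaE] := lift_linear (p := lincomb w) (h := mulmx Th) wsurj.
  exact/ThK/HK.
pose nm := nagata_map loc.
have [||th2 th2E] := @tensor_lift _ _ nm E _ (fun x => map_mx nm (theta x)).
- by move=> x y; rewrite linearD map_mxD.
- by move=> t x; rewrite linearZ map_mxZ.
pose alpha := \matrix_(i < r, l < c.+1) theta (a i) l 0.
have Qgen i : colon_rad s (d j 0) (loc (\det (mixed_mx alpha c i))).
  exists 1%N; rewrite expr1 -det_map_mx; set M := map_mx loc _.
  (* d is completed by 0 at the constant last row, so kap M gives the coordinates of s v; the
     adjugate then shows that s divides det M times d_j, without any power. *)
  pose kap : 'rV[R2]_c.+1 := \row_l if insub (val l) is Some j' then d j' 0 else 0.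
  have kapM : kap *m M = s *: (th2 v)^T.
    rewrite -linearZ -linearZ /= svE lincomb_linmap.
    apply/matrixP=> i0 l; rewrite /lincomb mxE [RHS]mxE summxE.
    rewrite big_ord_recr /= [X in _ + X = _](_ : _ = 0) ?addr0.
      apply: eq_bigr => j' _; rewrite !mxE /=.
      rewrite (valK j' : insub (nat_of_ord j') = Some j') ltn_ord mxE; congr (_ * _).
      rewrite rmorph_sum /generic_elt linear_sum summxE; apply: eq_bigr => i1 _.
      by rewrite linearZ /= th2E rmorphM !mxE ord1 mulrC.
    by rewrite mxE insubF ?mul0r // ltnn.
  have /matrixP/(_ 0 (widen_ord (leqnSn c) j)) : kap *m M *m \adj M = \det M *: kap.
    by rewrite -mulmxA mul_mx_adj mul_mx_scalar.
  rewrite kapM -scalemxAl mxE [RHS]mxE [kap _ _]mxE /=.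
  rewrite (valK j : insub (nat_of_ord j) = Some j) => <-.
  by eexists.
have Qdet i : Q (\det (\matrix_(l, l') theta (a (i l)) l' 0)).
  have := generic_descent locS sreg Qgen i.
  rewrite /Q /= /nagata_map /= -!det_map_mx; congr (colon_rad _ _ (\det _)).
  by apply/matrixP=> l l'; rewrite !mxE /=; case: insub.
(* On the generators indexed by L the coordinates form the scalar matrix delta^2, so the determinant
   is a power of delta. *)
have := reduction_det red Qid Qrad Qdet (w \o L).
have -> : \matrix_(l, l') theta ((w \o L) l) l' 0 = (colsub L Th)^T.
  apply/matrixP=> l l'; rewrite !mxE /= -[w (L l)]lincomb_delta thetaE.
  by transitivity (col (L l) Th l' 0); [rewrite colE | rewrite mxE].
by rewrite ThL tr_scalar_mx det_scalar => /Qrad/Qrad.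
Qed.

(** * Regular pairs and torsion-freeness over the Nagata extension *)

Lemma reg_pair_mpoly (R : comNzRingType) (n : nat) (b1 b2 : R) :
  reg_pair b1 b2 -> reg_pair (b1%:MP : {mpoly R[n]}) b2%:MP.
Proof.
move=> [reg1 reg2]; split.
  apply: mulrI0_lreg => u bu0; apply/mpolyP => m; rewrite mcoeff0.
  by apply: (lreg_mul0 reg1); rewrite -mcoeffCM bu0 mcoeff0.
move=> y z E; have /choice[c cE] : forall m, exists c, y@_m = b1 * c.
  by move=> m; apply: (reg2 _ z@_m); rewrite -!mcoeffCM E.
exists (\sum_(m <- msupp y) c m *: 'X_[m]).
rewrite mulr_sumr [LHS]mpolyE; apply: eq_bigr => m _.
by rewrite cE mul_mpolyC scalerA.
Qed.

Lemma reg_pair_loc (A B : comNzRingType) (S : set A) (f : {rmorphism A -> B}) b1 b2 :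
  is_localization S f -> reg_pair b1 b2 -> reg_pair (f b1) (f b2).
Proof.
move=> [unitS fracS kerS] [reg1 reg2]; split.
  apply: mulrI0_lreg => u bu0; have [a [t [/unitS[t' tt'] uE]]] := fracS u.
  have /kerS[t1 [/unitS[t1' tt1'] E]] : f (b1 * a) = 0.
    by rewrite rmorphM -uE mulrA bu0 mul0r.
  have ta0 : t1 * a = 0 by apply: (lreg_mul0 reg1); rewrite mulrCA.
  rewrite -[u]mulr1 -tt' mulrA uE -[LHS]mulr1 -tt1' mulrCA.
  transitivity (f (t1 * a) * t' * t1'); first by rewrite rmorphM; ring.
  by rewrite ta0 rmorph0 !mul0r.
move=> y z E12.
have [a1 [t1 [/unitS[t1' tt1'] yE]]] := fracS y.
have [a2 [t2 [/unitS[t2' tt2'] zE]]] := fracS z.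
have /kerS[t3 [/unitS[t3' tt3'] E3]] : f (b2 * (a1 * t2) - b1 * (a2 * t1)) = 0.
  rewrite rmorphB !rmorphM -yE -zE.
  transitivity ((f b2 * y - f b1 * z) * (f t1 * f t2)); first by ring.
  by rewrite E12 subrr mul0r.
have [|c cE] := reg2 (t3 * (a1 * t2)) (t3 * (a2 * t1)).
  by apply/eqP; rewrite -subr_eq0 !(mulrCA _ t3) -mulrBr E3.
exists (f c * (t1' * t2' * t3')).
transitivity (f t3 * (y * f t1 * f t2) * (t1' * t2' * t3')).
  transitivity (y * (f t1 * t1') * (f t2 * t2') * (f t3 * t3')); last by ring.
  by rewrite tt1' tt2' tt3' !mulr1.
by rewrite yE -!rmorphM cE rmorphM; ring.
Qed.

(** H kills the coordinates of a torsion element. After clearing denominators these are polynomials,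
    and for each monomial the vector of coefficients is killed by H over R, hence is a relation of
    the torsion-free E. *)
Lemma torsion_free_nagata (R R2 : comNzRingType) (r c e : nat) (E : lmodType R)
    (loc : {rmorphism {mpoly R[r * c]} -> R2}) (S : set {mpoly R[r * c]}) :
  is_localization S loc -> fin_gen E -> has_rank E e -> torsion_free E ->
  torsion_free (tensor (nagata_map loc) E).
Proof.
move=> locS /fin_genP[p [w wsurj]] Erank Etf v [s [sreg sv0]].
have [s0 [H [C [_ _ HK HK']]]] := rank_matrices wsurj Erank.
have [nu nuE] := @tensor_gen _ _ (nagata_map loc) _ _ _ wsurj v.
have [t [t' [N [tt' NE]]]] := loc_common_mx nu locS.
have Hnu : map_mx (nagata_map loc) H *m nu = 0.
  apply: (lreg_mulmx0 sreg); rewrite scalemxAr.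
  by apply: (tensor_relation_mx wsurj _ HK); rewrite linearZ /= nuE.
have [|t1 [t1' [tt1' t1E]]] := loc_ker_mx (M := map_mx (@mpolyC _ R) H *m N) locS.
  rewrite map_mxM -NE -map_mx_comp -scalemxAr.
  by rewrite -[map_mx _ H]/(map_mx (nagata_map loc) H) Hnu scaler0.
apply: (unit_mul0 tt1'); apply: (unit_mul0 tt').
rewrite -nuE -!linearZ /= NE.
pose co m := map_mx (mcoeff m) (t1 *: N).
have co0 m : lincomb w (co m) = 0.
  apply: HK' => //; apply/matrixP=> i j.
  have /matrixP/(_ i j) : map_mx (@mpolyC _ R) H *m (t1 *: N) = 0.
    by rewrite -scalemxAr t1E.
  move=> /(congr1 (mcoeff m)); rewrite mxE [X in _ = mcoeff _ X]mxE mcoeff0 raddf_sum /=.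
  move=> sum0; rewrite mxE [RHS]mxE -[RHS]sum0.
  by apply: eq_bigr => l _; rewrite !mxE mcoeffCM.
(* A common degree bound expands all entries over one finite set of monomials. *)
have [b bP] : exists b, forall i, (msize ((t1 *: N)%R i 0%R) <= b)%N.
  by exists (\max_(i < p) msize ((t1 *: N)%R i 0%R)) => i; apply: leq_bigmax.
have coE : map_mx loc (t1 *: N) =
    \sum_(m : bmultinom (r * c) b) loc 'X_[m] *: map_mx (nagata_map loc) (co m).
  apply/matrixP=> i j; rewrite summxE mxE ord1.
  rewrite {1}[(t1 *: N) i 0](@mpolywE _ _ b) ?bP //.
  rewrite rmorph_sum; apply: eq_bigr => m _.
  by rewrite !mxE -mul_mpolyC rmorphM mulrC.
rewrite -linearZ /= -map_mxZ coE linear_sum big1 // => m _.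
by rewrite linearZ /= -tens_lincomb co0 tens0 scaler0.
Qed.

Lemma torsion_free_coker (R R2 : comNzRingType) (r c : nat) (E : lmodType R)
    (a : 'I_r -> E) (loc : {rmorphism {mpoly R[r * c]} -> R2})
    (S : set {mpoly R[r * c]}) :
  is_localization S loc -> fin_gen E -> has_rank E c.+1 ->
  is_reduction (gen_submod (range a)) -> torsion_free E ->
  grade_ge (fitting E c.+1) 2 -> torsion_free (quotmod (generic_sub loc a)).
Proof.
move=> locS Efg Erank red Etf /grade_ge2P[b1 [b2 [F1 F2 reg12]]] z [s [sreg]].
have subF : is_submod (generic_sub loc a) by exact: gen_submodP.
rewrite -(qprojK z) -linearZ => /(qproj0 _ subF)/gen_submod_range[d dE].
apply/qproj0 => //.
have reg12' := reg_pair_loc locS (reg_pair_mpoly (r * c) reg12).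
have /choice[d' d'E] : forall j, exists d', d j 0 = s * d'.
  move=> j; have Q1 := fitting_colon_rad j locS Erank red sreg dE F1.
  have Q2 := fitting_colon_rad j locS Erank red sreg dE F2.
  (* With mu = 1 no power is lost, and s itself divides d_j. *)
  have [||N [d']] := @colon_rad_pair _ s (d j 0) 1 _ _ sreg _ _ Q1 Q2.
  - by move=> u /(lreg_mul0 reg12'.1) ->; exists 0%N; rewrite mulr0.
  - by move=> u1 u2 /reg12'.2[d' ->]; exists 0%N, d'; rewrite mul1r.
  by rewrite expr1n mul1r; exists d'.
apply/gen_submod_range; exists (\col_j d' j).
apply/eqP; rewrite -subr_eq0; apply/eqP.
apply: (torsion_free_nagata locS Efg Erank Etf); exists s; split=> //.
rewrite scalerBr dE scaler_sumr -sumrB big1 // => j _.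
by rewrite mxE scalerA -d'E subrr.
Qed.

(** * Generators over the Nagata extension *)

Lemma maximal_ideal_above (A : comNzRingType) (I : set A^o) :
  is_ideal I -> ~ I 1 -> exists J : set A^o, maximal_ideal J /\ I `<=` J.
Proof.
move=> Iid I1.
(* The union of the empty chain is empty and so not an ideal; adjoining I repairs this. *)
pose P (J : set A^o) := is_ideal (J `|` I) /\ ~ (J `|` I) 1.
have [|K [[Kid K1] Kmax]] := @Zorn_bigcup A^o P.
  move=> F FP Ftot; split; last by case=> [[X FX X1]|//]; case: (FP X FX) => _; apply; left.
  split; first by right; case: Iid.
  have lift X x : F X -> (X `|` I) x -> (\bigcup_(Y in F) Y `|` I) x.
    by move=> FX [Xx|Ix]; [left; exists X | right].
  move=> b x y [[X FX Xx]|Ix] [[Y FY Yy]|Iy].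
  - case: (Ftot X Y FX FY) => [XY|YX].
      by apply: (lift Y) => //; case: (FP Y FY) => -[_ +] _; apply; left => //; exact: XY.
    by apply: (lift X) => //; case: (FP X FX) => -[_ +] _; apply; left => //; exact: YX.
  - by apply: (lift X) => //; case: (FP X FX) => -[_ +] _; apply; [left|right].
  - by apply: (lift Y) => //; case: (FP Y FY) => -[_ +] _; apply; [right|left].
  - by right; case: Iid => _; apply.
exists (K `|` I); split; last by right.
split=> //; first by move=> KT; apply: K1; rewrite KT.
move=> J Jid KJ; have [J1|J1] := pselect (J 1).
  right; apply/seteqP; split=> // x _.
  by rewrite -[x]mulr1; apply: (ideal_mul (I := J)).
left; have JI : J `|` I = J.
  by apply/seteqP; split=> [x [//|Ix]|x Jx]; [apply: KJ; right | left].
apply: contrapT => JK; apply: (Kmax J); last by rewrite /P JI.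
split=> [x Kx|JK']; first by apply: KJ; left.
apply: JK; apply/seteqP; split=> // x Jx; left; exact: JK'.
Qed.

Lemma local_unit (A : comNzRingType) (m : set A^o) (a : A) :
  local_ring m -> ~ m a -> exists u, a * u = 1.
Proof.
move=> [_ mloc] ma; apply: contrapT => /forallNP nu.
pose I : set A^o := [set x | exists b, x = a * b].
have Iid : is_ideal I.
  split=> [|b _ _ [x ->] [y ->]]; first by exists 0; rewrite mulr0.
  by exists (b * x + y); rewrite mulrDr mulrCA.
have [|J [/mloc -> IJ]] := maximal_ideal_above Iid.
  by move=> [b /esym]; apply: nu.
by apply: ma; apply: IJ; exists 1; rewrite mulr1.
Qed.

Lemma maximal_ideal1 (A : comNzRingType) (m : set A^o) : maximal_ideal m -> ~ m 1.
Proof.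
move=> [mid mT _] m1; apply: mT; apply/seteqP; split=> // x _.
by rewrite -[x]mulr1; apply: (ideal_mul (I := m)).
Qed.

Lemma local_prime (A : comNzRingType) (m : set A^o) (a b : A) :
  local_ring m -> ~ m a -> ~ m b -> ~ m (a * b).
Proof.
move=> mloc /(local_unit mloc)[u au] /(local_unit mloc)[v bv] mab.
apply: (maximal_ideal1 mloc.1); have -> : 1 = (u * v) * (a * b).
  by transitivity ((a * u) * (b * v)); [rewrite au bv mulr1 | ring].
by case: mloc => -[mid _ _] _; apply: ideal_mul.
Qed.

Lemma extended_ideal_coef (R : comNzRingType) (n : nat) (m : set R^o)
    (u : {mpoly R[n]}) :
  is_ideal m ->
  gen_submod ((@mpolyC n R) @` m : set {mpoly R[n]}^o) u <-> forall mon, m u@_mon.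
Proof.
move=> mid; split.
  apply: (gen_submod_min (N := [set v : {mpoly R[n]}^o | forall mon, m v@_mon])).
    split=> [mon|b x y mx my mon]; first by rewrite mcoeff0; case: mid.
    rewrite mcoeffD; apply: ideal_add => //.
    rewrite -[b *: x]/(b * x : {mpoly R[n]}) mcoeffM.
    elim/big_ind: _ => [||k _]; [by case: mid | by move=> ? ?; apply: ideal_add |].
    exact: ideal_mul.
  move=> _ [b mb <-] mon; rewrite mcoeffC mulrC; exact: ideal_mul.
move=> mu; rewrite [u]mpolyE.
elim/big_ind: _ => [||mon _]; [exact: gen_submod0 | by move=> ? ?; apply: (gen_submodD (M := {mpoly R[n]}^o)) |].
rewrite -mul_mpolyC mulrC; apply: (gen_submodZ (M := {mpoly R[n]}^o)).
by apply: gen_submod_in; exists u@_mon.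
Qed.

(** Once the coefficients in m are discarded, both leading coefficients lie outside m; their product
    does too, and it is the leading coefficient of the product. *)
Lemma extended_ideal_prime (R : comNzRingType) (n : nat) (m : set R^o)
    (N := gen_submod ((@mpolyC n R) @` m : set {mpoly R[n]}^o)) (u v : {mpoly R[n]}) :
  local_ring m -> ~ N u -> ~ N v -> ~ N (u * v).
Proof.
move=> mloc; have mid : is_ideal m by case: mloc => -[].
have Nid : is_ideal N by exact: gen_submodP.
(* Modulo m R[Z], a polynomial is the part of it with unit coefficients. *)
pose top (w : {mpoly R[n]}) := \sum_(k <- msupp w | `[< ~ m w@_k >]) w@_k *: 'X_[k].
have topN w : N (w - top w).
  rewrite [w in w - _]mpolyE (bigID (fun k => `[< ~ m w@_k >])) /= -/(top w) addrAC subrr add0r.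
  elim/big_ind: _ => [||k /asboolP/contrapT mk]; [exact: gen_submod0 | by move=> ? ?; apply: (gen_submodD (M := {mpoly R[n]}^o)) |].
  rewrite -mul_mpolyC mulrC; apply: (gen_submodZ (M := {mpoly R[n]}^o)).
  by apply: gen_submod_in; exists w@_k.
have top_coef w k : (top w)@_k != 0 -> ~ m (top w)@_k.
  rewrite raddf_sum /=; under eq_bigr do rewrite mcoeffZ mcoeffX.
  rewrite -big_filter; have [kw|kw] := boolP (k \in [seq k <- msupp w | `[< ~ m w@_k >]]).
    rewrite (bigD1_seq k) //= ?filter_uniq ?msupp_uniq // eqxx mulr1.
    rewrite big1 ?addr0 => [|i ik]; last by rewrite (negPf ik) mulr0.
    by move=> _; move: kw; rewrite mem_filter => /andP[/asboolP].
  rewrite big_seq big1 ?eqxx // => i iw.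
  by case: eqP => [ik|_]; [rewrite -ik iw in kw | rewrite mulr0].
have top_lead w : ~ N w -> ~ m (mleadc (top w)).
  move=> Nw; apply: top_coef; rewrite mleadc_eq0; apply/eqP => top0.
  by apply: Nw; have := topN w; rewrite top0 subr0.
move=> /top_lead mu /top_lead mv Nuv.
have : N (top u * top v).
  have -> : top u * top v = u * v - (v * (u - top u) + top u * (v - top v)) by ring.
  have Nopp x : N x -> N (- x) by move=> Nx; rewrite -mulN1r; apply: (ideal_mul (I := N)).
  apply: (ideal_add (I := N)) => //; apply: Nopp.
  by apply: (ideal_add (I := N)) => //; apply: (ideal_mul (I := N)).
move/(extended_ideal_coef _ mid)/(_ (mlead (top u) + mlead (top v))%MM).
by rewrite mleadcM; apply: local_prime.
Qed.

(** J consists of the fractions with numerator in m R[Z]; it serves to compare numbers of generators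
    modulo a proper ideal. *)
Lemma nagata_residue (R R2 : comNzRingType) (n : nat) (m : set R^o)
    (loc : {rmorphism {mpoly R[n]} -> R2}) :
  local_ring m ->
  is_localization (~` (gen_submod ((@mpolyC n R) @` m : set {mpoly R[n]}^o))) loc ->
  exists J : set R2^o, [/\ is_ideal J, ~ J 1 & forall b, m b -> J (loc b%:MP)].
Proof.
move=> mloc; set N := gen_submod _ => -[unitS fracS kerS].
have mid : is_ideal m by case: mloc => -[].
have Nid : is_ideal N by exact: gen_submodP.
have Nprime u v : ~ N u -> ~ N v -> ~ N (u * v) by exact: extended_ideal_prime.
have N1 : ~ N 1.
  move/(extended_ideal_coef _ mid)/(_ 0%MM); rewrite mcoeff1 eqxx.
  exact: maximal_ideal1 mloc.1.
exists [set b | exists t P, [/\ ~ N t, N P & b * loc t = loc P]]; split.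
- split; first by exists 1, 0; split=> //; [case: Nid | rewrite rmorph0 mul0r].
  move=> b x y [tx [Px [ntx NPx xE]]] [ty [Py [nty NPy yE]]].
  have [a [t [nt bE]]] := fracS b.
  exists (t * tx * ty), (a * ty * Px + t * tx * Py); split.
  + exact: Nprime (Nprime _ _ nt ntx) nty.
  + by apply: (ideal_add (I := N)) => //; apply: (ideal_mul (I := N)).
  rewrite rmorphD !rmorphM -xE -yE -bE -[b *: x]/(b * x); ring.
- move=> [t [P [nt NP]]]; rewrite mul1r => /eqP; rewrite -subr_eq0 -rmorphB => /eqP.
  move=> /kerS[t' [nt' E]]; apply: (Nprime _ _ nt' nt).
  have -> : t' * t = t' * P by apply/eqP; rewrite -subr_eq0 -mulrBr E.
  exact: (ideal_mul (I := N)).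
move=> b mb; exists 1, b%:MP; split=> //; last by rewrite rmorph1 mulr1.
by apply: gen_submod_in; exists b.
Qed.

Lemma det_congr_ideal (A : comNzRingType) (n : nat) (J : set A^o) (M M' : 'M[A]_n) :
  is_ideal J -> (forall i j, J (M i j - M' i j)) -> J (\det M - \det M').
Proof.
move=> Jid MM'; have J0 : J 0 by case: Jid.
rewrite /determinant; elim/big_rec2: _ => [|s x y _ IH]; first by rewrite subrr.
have -> : forall u v : A, u + y - (v + x) = (u - v) + (y - x) by move=> u v; ring.
apply: ideal_add => //; rewrite -mulrBr; apply: ideal_mul => //.
elim/big_rec2: _ => [|i u v _ IH']; first by rewrite subrr.
have -> : M i (s i) * v - M' i (s i) * u =
    v * (M i (s i) - M' i (s i)) + M' i (s i) * (v - u) by ring.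
by apply: ideal_add => //; apply: ideal_mul.
Qed.

Lemma drop_generator (A : comNzRingType) (M : lmodType A) (p : nat)
    (w : 'I_p.+1 -> M) (d : 'cV[A]_p.+1) i0 u :
  surj (lincomb w) -> lincomb w d = 0 -> d i0 0 * u = 1 ->
  surj (lincomb (fun i => w (fintype.lift i0 i))).
Proof.
move=> wsurj d0 du x; have [c cE] := wsurj x.
pose c' := c - (c i0 0 * u) *: d.
exists (row' i0 c'); rewrite -cE.
have -> : lincomb w c = lincomb w c'.
  by rewrite /c' linearB linearZ /= d0 scaler0 subr0.
rewrite [RHS]/lincomb (bigD1_ord i0) //=.
rewrite [c' i0 0](_ : _ = 0); last by rewrite !mxE -mulrA [u * _]mulrC du mulr1 subrr.
by rewrite scale0r add0r; apply: eq_bigr => i _; rewrite mxE.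
Qed.

(** For a minimal number p of generators of E all relations have coefficients in m. Rewriting them
    through y and back gives a product congruent to 1 modulo J, with determinant 0 if e < p; hence p
    <= e. The rank gives e <= p, and then det H, a divisor of s^e, is regular, so there are no
    relations. *)
Lemma free_of_few_generators (R R2 : comNzRingType) (r c e : nat) (m : set R^o)
    (E : lmodType R) (loc : {rmorphism {mpoly R[r * c]} -> R2})
    (y : 'I_e -> tensor (nagata_map loc) E) :
  local_ring m -> is_nagata loc m -> fin_gen E -> has_rank E e ->
  surj (lincomb y) -> free_fin_rank E.
Proof.
move=> mloc locS /fin_genP gens Erank ysurj.
pose has_gens p := `[< exists w : 'I_p -> E, surj (lincomb w) >].
have ex_gens : exists p, has_gens p by case: gens => p ?; exists p; apply/asboolP.
have [p /asboolP[w wsurj] pmin] := ex_minnP ex_gens.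
have rel_m d i : lincomb w d = 0 -> m (d i 0).
  move=> d0; apply: contrapT => /(local_unit mloc)[u du].
  case: p w wsurj pmin d i d0 du => [|p] w wsurj pmin d i d0 du; first by case: i du.
  have /asboolP/pmin : exists w : 'I_p -> E, surj (lincomb w).
    by exists (fun j => w (fintype.lift i j)); apply: drop_generator d0 du.
  by rewrite ltnn.
have [s [H [C [sreg HC HK _]]]] := rank_matrices wsurj Erank.
have pe : (p <= e)%N.
  have [J [Jid J1 Jm]] := nagata_residue mloc locS.
  have /choice[B BE] := fun i => ysurj (tens (nagata_map loc) (w i)).
  have /choice[A AE] := fun j => @tensor_gen _ _ (nagata_map loc) _ _ _ wsurj (y j).
  pose MA := \matrix_(i, j) A j i 0; pose MB := \matrix_(j, i) B i j 0.
  rewrite leqNgt; apply/negP => ep; apply: J1.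
  have := @det_congr_ideal _ _ J 1%:M (MA *m MB) Jid.
  rewrite det1 det_mulmx_wide // subr0; apply=> i j.
  have : lincomb (fun i => tens (nagata_map loc) (w i))
           (delta_mx j 0 - MA *m col j MB) = 0.
    rewrite linearB /= lincomb_delta lincomb_mul -[tens _ (w j)]BE.
    apply/eqP; rewrite subr_eq0; apply/eqP; apply: eq_bigr => l _.
    rewrite !mxE -AE; congr (_ *: lincomb _ _).
    by apply/matrixP=> a b; rewrite !mxE ord1.
  move=> /(tensor_relation wsurj) rel.
  have JX : is_submod [set v : 'cV[R2]_p | forall i, J (v i 0)].
    split=> [i'|b v1 v2 J1' J2 i']; first by rewrite mxE; case: Jid.
    by rewrite !mxE; case: Jid => _; apply.
  have {}rel := gen_submod_min JX _ rel; have : J ((delta_mx j 0 - MA *m col j MB) i 0).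
    apply: rel => _ [d [dm ->]] i' /=; rewrite mxE; apply: Jm; exact: rel_m.
  rewrite !mxE eqxx andbT; congr (J (_ - _)).
  by apply: eq_bigr => l _; rewrite !mxE.
have ep : (e <= p)%N.
  rewrite leqNgt; apply/negP => pe'.
  have /eqP := det_mulmx_wide H C pe'; rewrite HC det_scalar.
  exact/negP/(lreg_neq0 (lregX sreg)).
have Ep : p = e by apply/eqP; rewrite eqn_leq pe ep.
subst p; exists e.
have detH : GRing.lreg (\det H).
  apply: mulrI0_lreg => b Hb0; apply: (lreg_mul0 (@lregX _ _ e sreg)).
  by rewrite -det_scalar -HC det_mulmx mulrAC Hb0 mul0r.
have winj d : lincomb w d = 0 -> d = 0.
  move=> /HK Hd0; apply: (lreg_mulmx0 detH).
  by rewrite -mul_scalar_mx -mul_adj_mx -mulmxA Hd0 mulmx0.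
have [g gE] := lift_linear (p := lincomb w) (h := idfun) wsurj winj.
exists g; exists (lincomb w) => [x|d]; last exact: gE.
by have [d <-] := wsurj x; rewrite gE.
Qed.

(** * Generic Bourbaki ideals *)

(** The certificate for generators w of E is carried to x by change-of-generators matrices.
    [MA *m MB] differs from 1 by relations, which H kills, so H C = s persists. *)
Lemma rank_matrices_nagata (R R2 : comNzRingType) (r c e n q : nat)
    (E : lmodType R) (loc : {rmorphism {mpoly R[r * c]} -> R2})
    (S : set {mpoly R[r * c]}) (x : 'I_n -> tensor (nagata_map loc) E)
    (phi : 'M[R2]_(n, q)) :
  is_localization S loc -> fin_gen E -> has_rank E e -> presents phi x ->
  exists (s : R2) (H : 'M[R2]_(e, n)) (C : 'M[R2]_(n, e)),
    [/\ GRing.lreg s, H *m C = s%:M & H *m phi = 0].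
Proof.
move=> locS /fin_genP[p' [w wsurj]] Erank [xphi xsurj].
have [s [H [C [sreg HC HK _]]]] := rank_matrices wsurj Erank.
pose nm := nagata_map loc; pose tw l := tens nm (w l).
have /choice[A AE] := fun i => @tensor_gen _ _ nm _ _ _ wsurj (x i).
have /choice[B BE] := fun l => xsurj (tw l).
pose MA := \matrix_(l, i) A i l 0; pose MB := \matrix_(i, l) B l i 0.
have HKtw u : lincomb tw u = 0 -> map_mx nm H *m u = 0.
  by move=> u0; apply: (tensor_relation_mx wsurj u0 HK).
have xMA u : lincomb tw (MA *m u) = lincomb x u.
  rewrite lincomb_mul; apply: eq_bigr => i _; rewrite -AE; congr (_ *: lincomb _ _).
  by apply/matrixP=> a b; rewrite !mxE ord1.
have twMB u : lincomb x (MB *m u) = lincomb tw u.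
  rewrite lincomb_mul; apply: eq_bigr => l _; rewrite -[tw l]BE; congr (_ *: lincomb _ _).
  by apply/matrixP=> a b; rewrite !mxE ord1.
have HAB : map_mx nm H *m (MA *m MB) = map_mx nm H.
  apply/eqP; rewrite -subr_eq0 -[X in _ - X]mulmx1 -mulmxBr; apply/eqP.
  apply/matrixP=> i l; have : map_mx nm H *m ((MA *m MB - 1%:M) *m delta_mx l (0 : 'I_1)) = 0.
    apply: HKtw; rewrite mulmxBl mul1mx linearB /= -mulmxA xMA twMB subrr //.
  by rewrite mulmxA -colE => /matrixP/(_ i 0); rewrite !mxE.
have nm_reg : GRing.lreg (nm s).
  have reg1 : reg_pair s 1 by split=> // y z; rewrite mul1r; exists z.
  exact: (reg_pair_loc locS (reg_pair_mpoly (r * c) reg1)).1.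
exists (nm s), (map_mx nm H *m MA), (MB *m map_mx nm C); split=> //.
  by rewrite mulmxA -[_ *m MA *m MB]mulmxA HAB -map_mxM HC map_scalar_mx.
apply/matrixP=> i j; have : map_mx nm H *m (MA *m (phi *m delta_mx j (0 : 'I_1))) = 0.
  by apply: HKtw; rewrite xMA; apply/xphi; exists (delta_mx j 0).
by rewrite !mulmxA -colE => /matrixP/(_ i 0); rewrite !mxE.
Qed.

(** The class of y0 corresponds to 1 under f, so it generates the quotient; y0 and the y_j generate
    M. *)
Lemma coker_cyclic_generators (A : comNzRingType) (M : lmodType A) (c k : nat)
    (psi : 'M[A]_(k.+1, k)) (y : 'I_c -> M) (z : 'I_k.+1 -> quotmod (gen_submod (range y)))
    (f : {linear quotmod (gen_submod (range y)) -> submod (minors k psi)}) :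
  surj (lincomb z) -> (forall v, submod_val (f (lincomb z v)) = bordered_det psi v) ->
  (forall u, f u = 0 -> u = 0) -> minors k psi 1 ->
  exists y' : 'I_c.+1 -> M, surj (lincomb y').
Proof.
move=> zsurj fE finj /minors_bordered_det[v0 v0E]; set X := gen_submod (range y) in z f zsurj fE finj *.
pose y0 := repr (lincomb z v0); have y0E : qproj X y0 = lincomb z v0 by exact: qprojK.
pose y' (l : 'I_(1 + c)) := match split l with inl _ => y0 | inr j => y j end.
exists y' => u; have [v vE] := zsurj (qproj X u).
have : qproj X (u - bordered_det psi v *: y0) = 0.
  have -> : qproj X (u - bordered_det psi v *: y0) = lincomb z (v - bordered_det psi v *: v0).
    transitivity (qproj X u - bordered_det psi v *: qproj X y0).
      by rewrite linearB; congr (_ - _); exact: linearZ.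
    by rewrite y0E -vE [RHS]linearB; congr (_ - _); exact/esym/linearZ.
  apply: finj; apply: submod_val_inj; rewrite fE linear0 -scaleN1r bordered_detD !bordered_detZ -v0E.
  by rewrite mulr1 mulN1r subrr.
move/(qproj0 _ (gen_submodP _))/gen_submod_range => [d dE].
exists (col_mx (const_mx (bordered_det psi v)) d : 'cV_(1 + c)).
rewrite (lincomb_split (c := 1)) col_mxKu col_mxKd /lincomb big_ord1 mxE.
have yl : y' (lshift c 0) = y0 by rewrite /y' (unsplitK (inl _)).
have yr j : y' (rshift 1 j) = y j by rewrite /y' (unsplitK (inr _)).
by rewrite yl; under eq_bigr do rewrite yr; rewrite -dE addrC subrK.
Qed.

Theorem theorem5p3
  (R : comNzRingType) (m : set R^o) (E : lmodType R) (e r : nat)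
  (a : 'I_r -> E)
  (R2 : comNzRingType) (loc : {rmorphism {mpoly R[r * e.-1]} -> R2})
  (k q : nat)
  (x : 'I_(e.-1 + k.+1) -> tensor (nagata_map loc) E)
  (phi : 'M[R2]_(e.-1 + k.+1, q)) (psi : 'M[R2]_(k.+1, k)) (g : 'I_k -> 'I_q)
  (R_noetherian : noetherian R) (R_local : local_ring m)
  (E_fg : fin_gen E) (e_ge2 : (2 <= e)%N) (E_rank : has_rank E e)
  (U_reduction : is_reduction (gen_submod (range a)))
  (R2_nagata : is_nagata loc m)
  (x_generic : forall j : 'I_e.-1, x (lshift k.+1 j) = generic_elt loc a j)
  (phi_presents : presents phi x)
  (g_increasing : {homo g : i j / (i < j)%N})
  (psi_submatrix : psi = mxsub (@rshift e.-1 k.+1) g phi)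
  (psi_grade : grade_ge (minors k psi) 1) :
  (exists d : {linear 'cV[R2]_k.+1 -> submod (minors k psi)},
     (forall i : 'I_k.+1,
        submod_val (d (delta_mx i 0)) = (-1) ^+ i * \det (row' i psi)) /\
     (forall w : 'cV[R2]_k, d (psi *m w) = 0)) /\
  (grade_ge (fitting E e) 2 ->
   (torsion_free E -> exists I : set R2^o, generic_bourbaki loc a I) /\
   (forall I : set R2^o, generic_bourbaki loc a I ->
      iso_mod (submod I) (submod (minors k psi))) /\
   (~ free_fin_rank E -> grade_ge (minors k psi) 2 ->
      exists (I : set R2^o)
             (f : {linear quotmod (generic_sub loc a) -> submod I}),
        [/\ generic_bourbaki loc a I /\ bijective f,
            perfect_ideal I 2,
            exists d : {linear 'cV[R2]_k.+1 -> submod I},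
              short_exact (fun w : 'cV[R2]_k => psi *m w) d,
            presents psi (fun i : 'I_k.+1 =>
              f (qproj (generic_sub loc a) (x (rshift e.-1 i))))
          & I = minors k psi])).
Proof.
have [d [dE dsurj]] := bordered_det_corestrict psi.
split.
  exists d; split=> [i|w]; first by rewrite dE bordered_det_delta.
  by apply: submod_val_inj; rewrite dE bordered_det_mul linear0.
case: e e_ge2 => // c _ in loc x phi E_rank R2_nagata x_generic phi_presents psi_submatrix *.
rewrite /= in loc x phi R2_nagata x_generic phi_presents psi_submatrix *.
have [s [H [C [sreg HC Hphi]]]] := rank_matrices_nagata R2_nagata E_fg E_rank phi_presents.
have [] := coker_minors g phi_presents x_generic sreg HC Hphi.
rewrite -psi_submatrix -/(generic_sub loc a) => f [fE fsurj fker].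
pose z i := qproj (generic_sub loc a) (x (rshift c i)).
have [zker zsurj] : presents (dsubmx phi) z by exact: coker_presents.
move=> gradeF; split=> [Etf|].
  exists (minors k psi); split; first exact: minors_ideal.
  exists f; apply: coker_iso => //.
  exact: torsion_free_coker R2_nagata E_fg E_rank U_reduction Etf gradeF.
split=> [I [Iid [h [h' hK h'K]]]|nfree grade2].
  (* The quotient is torsion-free because h embeds it in R''. *)
  have fbij : bijective f.
    apply: coker_iso => // u [t [treg tu0]]; apply: (can_inj hK); apply: submod_val_inj.
    rewrite !linear0; apply: treg; rewrite mulr0.
    by rewrite -[LHS]/(t *: submod_val (h u)) -!linearZ tu0 !linear0.
  have [||F FE] := lift_linear (p := h) (h := f).
  - by move=> v; exists (h' v).
  - by move=> u hu0; rewrite (can_inj hK (_ : h u = h 0)) ?linear0.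
  exists F; case: fbij => f' fK f'K; exists (h \o f').
    by move=> v; rewrite -[v]h'K FE /= fK.
  by move=> v; rewrite /= FE f'K.
have [b1 [b2 [Ib1 Ib2 reg12]]] := grade_ge2P grade2.
have finj u : f u = 0 -> u = 0.
  have [v <-] := zsurj u; rewrite -[\sum_i _]/(lincomb z v) => fv0.
  have [|w ->] := bordered_det_exact Ib1 Ib2 reg12 (v := v).
    by rewrite -fE -/z fv0 linear0.
  apply/zker; exists (colsub g 1%:M *m w); rewrite mulmxA mulmx_colsub mulmx1.
  by rewrite psi_submatrix; congr (_ *m _); apply/matrixP=> i j; rewrite !mxE.
have fbij : bijective f.
  apply: inj_surj_bij => // u v /eqP; rewrite -subr_eq0 -linearB => /eqP/finj/eqP.
  by rewrite subr_eq0 => /eqP.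
have I1 : ~ minors k psi 1.
  move=> I1; apply: nfree.
  have [y ysurj] := coker_cyclic_generators zsurj fE finj I1.
  exact: free_of_few_generators R_local R2_nagata E_fg E_rank ysurj.
exists (minors k psi), f; split=> //.
- by split=> //; split; [exact: minors_ideal | exists f].
- exact: minors_perfect.
- by exists d; apply: bordered_det_short_exact.
split=> [v|t].
  rewrite -[\sum_i _]/(lincomb (f \o z) v) -lincomb_linmap; split=> [fv0|[w <-]].
    have [|w ->] := bordered_det_exact Ib1 Ib2 reg12 (v := v); last by exists w.
    by rewrite -fE fv0 linear0.
  by apply: submod_val_inj; rewrite fE bordered_det_mul linear0.
have [u <-] := fsurj t; have [v <-] := zsurj u; exists v.
by rewrite -[LHS]/(lincomb (f \o z) v) -lincomb_linmap.
Qed.
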